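(* Let $X=\{(\alpha,\beta,\tau): -\tau<-\alpha<\beta<\tau,\ \alpha<\beta,\ Q(\alpha,\beta;\tau)=0\}$ (the parameter set of $\mathrm{oH}$ with $a<b$). For $0<\alpha<\tau$, the point $(\alpha,\alpha,\tau)$ (an $\mathrm{oP}$ surface) lies in the closure of $X$ if and only if $$\bar K(m_1)E(m_2)+m_2\bar E(m_1)K(m_2)=\bar K(m_1)K(m_2),\qquad m_1=\frac{\alpha^2+4}{\tau^2+4},\quad m_2=\frac{\alpha^2}{\tau^2}\frac{\tau^2+4}{\alpha^2+4},$$ where $0<m_1,m_2<1$.
   Context: For real $\alpha,\beta,\tau$ with $-\tau<-\alpha<\beta<\tau$ put $g_1(\zeta)=|\zeta+\alpha|^{1/2}|\zeta-\beta|^{-1/2}(\tau^2-\zeta^2)^{-1/2}(\zeta^2+4)^{-1/2}$ and $g_2(\zeta)=|\zeta+\alpha|^{-1/2}|\zeta-\beta|^{1/2}(\tau^2-\zeta^2)^{-1/2}(\zeta^2+4)^{-1/2}$, $I_1=\int_{-\tau}^{-\alpha}g_1$, $I_2=\int_{-\alpha}^{\beta}g_1$, $I_3=\int_{\beta}^{\tau}g_1$, $J_k$ likewise with $g_2$, and $Q(\alpha,\beta;\tau)=\frac{I_1+I_3}{I_2}-\frac{J_1+J_3}{J_2}$. Under $\alpha=a-1/a$, $\beta=b-1/b$, $\tau=t-1/t$ (with $a,b,t>0$, $1/t<1/a<b<t$), $Q=0$ is the period condition for the surfaces of the class $\mathcal O$, $\alpha=\beta$ corresponds to $\mathrm{oP}$,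 and $a<b$ iff $\alpha<\beta$. $K(m)=\int_0^{\pi/2}(1-m\sin^2\theta)^{-1/2}d\theta$, $E(m)=\int_0^{\pi/2}(1-m\sin^2\theta)^{1/2}d\theta$, $\bar K(m)=K(1-m)$, $\bar E(m)=E(1-m)$. *)

(* Defs.v *)
From Stdlib Require Import Reals Lra ClassicalEpsilon.
Open Scope R_scope.

(* Improper (Riemann) integral over the open interval (a,b): the limit of
   Riemann integrals over [c,d] as c -> a+, d -> b-.  For proper integrands it
   agrees with the ordinary Riemann integral. *)
Definition improper_integral (f : R -> R) (a b I : R) : Prop :=
  forall eps, 0 < eps -> exists delta, 0 < delta /\
    forall c d, a < c -> c < a + delta -> b - delta < d -> d < b -> c < d ->
      exists pr : Riemann_integrable f c d, Rabs (RiemannInt pr - I) < eps.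

Definition impint (f : R -> R) (a b : R) : R :=
  epsilon (inhabits 0) (fun I => improper_integral f a b I).

Definition g1 (al be tau : R) (z : R) : R :=
  sqrt (Rabs (z + al)) / sqrt (Rabs (z - be)) / sqrt (tau ^ 2 - z ^ 2)
  / sqrt (z ^ 2 + 4).

Definition g2 (al be tau : R) (z : R) : R :=
  sqrt (Rabs (z - be)) / sqrt (Rabs (z + al)) / sqrt (tau ^ 2 - z ^ 2)
  / sqrt (z ^ 2 + 4).

Definition Qfun (al be tau : R) : R :=
  let I1 := impint (g1 al be tau) (- tau) (- al) in
  let I2 := impint (g1 al be tau) (- al) be in
  let I3 := impint (g1 al be tau) be tau in
  let J1 := impint (g2 al be tau) (- tau) (- al) in
  let J2 := impint (g2 al be tau) (- al) be in
  let J3 := impint (g2 al be tau) be tau in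
  (I1 + I3) / I2 - (J1 + J3) / J2.

(* Complete elliptic integrals K(m), E(m) (parameter convention m = k^2). *)
Definition ellK (m : R) : R :=
  impint (fun th => / sqrt (1 - m * (sin th) ^ 2)) 0 (PI / 2).
Definition ellE (m : R) : R :=
  impint (fun th => sqrt (1 - m * (sin th) ^ 2)) 0 (PI / 2).
Definition ellKbar (m : R) : R := ellK (1 - m).
Definition ellEbar (m : R) : R := ellE (1 - m).

Definition Xset (al be tau : R) : Prop :=
  - tau < - al /\ - al < be /\ be < tau /\ al < be /\ Qfun al be tau = 0.

(* (x,y,z) lies in the (Euclidean-topology) closure of X; the max-norm
   neighbourhoods used here generate the same topology on R^3. *)
Definition in_closure_X (x y z : R) : Prop :=
  forall eps, 0 < eps -> exists al be tau, Xset al be tau /\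
    Rabs (al - x) < eps /\ Rabs (be - y) < eps /\ Rabs (tau - z) < eps.

(* Main.v *)
(** Write [al = r - c], [be = r + c].  Substitutions that stay regular as
    [c -> 0] turn the six singular integrals of [Qfun] into integrals over
    [[0, PI/2]] of kernels continuous in all parameters; the ones on
    [(-tau, -al)] come from those on [(be, tau)] by [z -> - z], [c -> - c].
    Separating the parts even and odd in [c] shows that [Qfun = 0] is equivalent
    to [c * M c r t = 0], where [M] is continuous up to the diagonal [c = 0].
    There [M 0 r t] reduces to complete elliptic integrals and is a negative
    multiple of the difference of the two sides of the stated equation.
    So the equation is necessary for being in the closure.  Conversely, at a zero
    move [(r, t)] along the curve on which [m1] is constant: [m2] is then strictly
    monotone, and as [ellD m2 / ellK m2] is strictly increasing, [M 0] changes
    sign; at a fixed small [c > 0] the intermediate value theorem gives a zero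
    of [M c] on this curve. *)

Require Import Defs.
From Stdlib Require Import Reals Lra ClassicalEpsilon Ranalysis5.
From Coquelicot Require Import Coquelicot.
Open Scope R_scope.

(** * Continuity and improper integrals *)

(** By the symmetry [z -> - z], the quotient formed from [g2] is the one formed from [g1] with [c]
    replaced by [- c]. Hence [Qfun] is odd in [c] and vanishes identically on the diagonal: its
    first-order coefficient there, not its value, decides which diagonal points are limits. This
    coefficient is reached without differentiating under the integral sign. The difference quotients
    in [c] are written in closed form, using conjugates of the square roots, and joint continuity of
    the resulting kernels gives continuity of [M]. A sign change and the intermediate value theorem
    then take the place of an implicit function argument. The curve of constant [m1] is natural
    because the equation separates as [ellEbar m1 / ellKbar m1 = ellD m2 / ellK m2], with
    [ellD m = (ellK m - ellE m) / m]; along the curve only the right-hand side moves. *)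

Lemma continuous_Rplus {U : UniformSpace} (f g : U -> R) (x : U) :
  continuous f x -> continuous g x -> continuous (fun u => f u + g u) x.
Proof. exact (continuous_plus (V := R_NormedModule) f g x). Qed.

Lemma continuous_Ropp {U : UniformSpace} (f : U -> R) (x : U) :
  continuous f x -> continuous (fun u => - f u) x.
Proof. exact (continuous_opp (V := R_NormedModule) f x). Qed.

Lemma continuous_Rminus {U : UniformSpace} (f g : U -> R) (x : U) :
  continuous f x -> continuous g x -> continuous (fun u => f u - g u) x.
Proof. exact (continuous_minus (V := R_NormedModule) f g x). Qed.

Lemma continuous_Rmult {U : UniformSpace} (f g : U -> R) (x : U) :
  continuous f x -> continuous g x -> continuous (fun u => f u * g u) x.
Proof. exact (continuous_mult (K := R_AbsRing) f g x). Qed.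

Lemma continuous_inv {U : UniformSpace} (f : U -> R) (x : U) :
  continuous f x -> f x <> 0 -> continuous (fun u => / f u) x.
Proof.
  intros Hf H0. apply (continuous_comp f Rinv); [exact Hf|].
  now apply continuous_Rinv.
Qed.

Lemma continuous_Rdiv {U : UniformSpace} (f g : U -> R) (x : U) :
  continuous f x -> continuous g x -> g x <> 0 ->
  continuous (fun u => f u / g u) x.
Proof.
  intros Hf Hg H0. apply continuous_Rmult; [exact Hf|now apply continuous_inv].
Qed.

Lemma continuous_pow {U : UniformSpace} (f : U -> R) (n : nat) (x : U) :
  continuous f x -> continuous (fun u => f u ^ n) x.
Proof.
  intros Hf. induction n as [|n IH]; simpl.
  - apply continuous_const.
  - now apply continuous_Rmult.
Qed.

(** The goals left by quotients and inverses are nonvanishing denominators. Square roots leave none: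
    [sqrt] is continuous on all of [R], with value 0 on negative arguments. *)
Ltac cont :=
  match goal with
  | |- continuous (fun u => ?k) _ => apply continuous_const
  | |- continuous (fun u => u) _ => apply continuous_id
  | |- continuous (fun u => ?f + ?g) _ =>
      apply (continuous_Rplus (fun u => f) (fun u => g)); cont
  | |- continuous (fun u => ?f - ?g) _ =>
      apply (continuous_Rminus (fun u => f) (fun u => g)); cont
  | |- continuous (fun u => - ?f) _ => apply (continuous_Ropp (fun u => f)); cont
  | |- continuous (fun u => ?f * ?g) _ =>
      apply (continuous_Rmult (fun u => f) (fun u => g)); cont
  | |- continuous (fun u => ?f / ?g) _ =>
      apply (continuous_Rdiv (fun u => f) (fun u => g)); [cont | cont |]
  | |- continuous (fun u => / ?f) _ =>
      apply (continuous_inv (fun u => f)); [cont |]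
  | |- continuous (fun u => ?f ^ ?n) _ =>
      apply (continuous_pow (fun u => f) n); cont
  | |- continuous (fun u => sqrt ?f) _ =>
      apply (continuous_comp (fun u => f) sqrt); [cont | apply continuous_sqrt]
  | |- continuous (fun u => Rabs ?f) _ =>
      apply (continuous_comp (fun u => f) Rabs); [cont | apply continuous_Rabs]
  | |- continuous (fun u => sin ?f) _ =>
      apply (continuous_comp (fun u => f) sin); [cont | apply continuous_sin]
  | |- continuous (fun u => cos ?f) _ =>
      apply (continuous_comp (fun u => f) cos); [cont | apply continuous_cos]
  | |- continuous (fun u => fst ?f) _ =>
      apply (continuous_comp (fun u => f) fst);
      [cont | let a := fresh in let b := fresh in
              match goal with |- continuous _ ?x => destruct x as [a b] end;
              apply continuous_fst]
  | |- continuous (fun u => snd ?f) _ =>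
      apply (continuous_comp (fun u => f) snd);
      [cont | let a := fresh in let b := fresh in
              match goal with |- continuous _ ?x => destruct x as [a b] end;
              apply continuous_snd]
  | |- continuous ?f _ => assumption
  | H : _ |- continuous _ _ => apply H
  | |- _ => idtac
  end.

Lemma ex_RInt_cont (f : R -> R) (a b : R) :
  (forall x, continuous f x) -> ex_RInt f a b.
Proof. intros H. apply (ex_RInt_continuous (V := R_CompleteNormedModule)). auto. Qed.

(** A tube lemma: continuity at each [(u0, t)] gives a radius depending on [t], and compactness of
    [[a, b]] turns these radii into one. *)
Lemma uniform_param_continuity {U : UniformSpace} (f : U -> R -> R) (a b : R)
    (u0 : U) :
  (forall t, continuous (fun p : U * R => f (fst p) (snd p)) (u0, t)) ->
  forall eps : R, 0 < eps ->
  locally u0 (fun u => forall s, a <= s <= b -> Rabs (f u s - f u0 s) < eps).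
Proof.
  intros Hc eps Heps.
  assert (He : 0 < eps / 2) by lra.
  assert (Hd : forall t, exists d : posreal, forall u s,
     ball u0 d u -> Rabs (s - t) < d -> Rabs (f u s - f u0 t) < eps / 2).
  { intros t.
    destruct (proj1 (filterlim_locally _ _) (Hc t) (mkposreal _ He)) as [d Hd].
    exists d. intros u s Hu Hs. apply (Hd (u, s)). split; [exact Hu|exact Hs]. }
  pose (delta := fun t => proj1_sig (constructive_indefinite_description _ (Hd t))).
  assert (Hdelta : forall t u s, ball u0 (delta t) u -> Rabs (s - t) < delta t ->
            Rabs (f u s - f u0 t) < eps / 2).
  { intros t. unfold delta.
    destruct (constructive_indefinite_description _ (Hd t)); auto. }
  (* The compactness lemma takes the radii as a function of [t], hence the choice above; it provides
     the nearby [t] only up to double negation, hence [NNPP] below. *)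
  destruct (compactness_value_1d a b delta) as [d Hdd].
  exists d. intros u Hu s Hs.
  apply NNPP. intros Hn. apply (Hdd s Hs). intros [t [Ht [Hst Hdt]]].
  apply Hn.
  assert (H1 := Hdelta t u s (ball_le _ _ _ Hdt _ Hu) Hst).
  assert (H2 := Hdelta t u0 s (ball_center _ _) Hst).
  replace (f u s - f u0 s) with ((f u s - f u0 t) - (f u0 s - f u0 t)) by ring.
  eapply Rle_lt_trans; [apply Rabs_triang|]. rewrite Rabs_Ropp. lra.
Qed.

Lemma continuous_RInt_param {U : UniformSpace} (f : U -> R -> R) (a b : R)
    (u0 : U) :
  a < b ->
  (forall t, continuous (fun p : U * R => f (fst p) (snd p)) (u0, t)) ->
  locally u0 (fun u => forall t, continuous (f u) t) ->
  continuous (fun u => RInt (f u) a b) u0.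
Proof.
  intros Hab Hc Hl. apply filterlim_locally. intros eps.
  (* The factor 2 leaves room for strictness, since the integral estimate below is only a weak
     inequality. *)
  assert (He : 0 < eps / (2 * (b - a))).
  { apply Rdiv_lt_0_compat; [apply eps|lra]. }
  generalize (filter_and _ _ Hl (uniform_param_continuity f a b u0 Hc _ He)).
  apply filter_imp. intros u [Hu Hs].
  assert (Hu0 : forall t, continuous (f u0) t) by exact (locally_singleton _ _ Hl).
  change (Rabs (RInt (f u) a b - RInt (f u0) a b) < eps).
  rewrite <- (RInt_minus (f u) (f u0)) by now apply ex_RInt_cont.
  apply Rle_lt_trans with ((b - a) * (eps / (2 * (b - a)))).
  - apply (abs_RInt_le_const (fun x => minus (f u x) (f u0 x))); [lra| |].
    + apply (ex_RInt_minus (V := R_NormedModule)); now apply ex_RInt_cont.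
    + intros t Ht. left. now apply Hs.
  - replace ((b - a) * (eps / (2 * (b - a)))) with (eps / 2) by (field; lra).
    generalize (cond_pos eps). lra.
Qed.

Lemma improper_integral_unique (f : R -> R) (a b I J : R) :
  a < b -> improper_integral f a b I -> improper_integral f a b J -> I = J.
Proof.
  intros Hab HI HJ. apply NNPP. intros Hne.
  assert (He : 0 < Rabs (I - J) / 2).
  { assert (0 < Rabs (I - J)) by (apply Rabs_pos_lt; lra). lra. }
  destruct (HI _ He) as [d1 [Hd1 H1]]. destruct (HJ _ He) as [d2 [Hd2 H2]].
  (* The cap [b - a] keeps the common test interval [[a + e / 3, b - e / 3]] nondegenerate. *)
  set (e := Rmin (Rmin d1 d2) (b - a)).
  assert (Hm := Rmin_l (Rmin d1 d2) (b - a)).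
  assert (Hm' := Rmin_r (Rmin d1 d2) (b - a)).
  assert (Hm1 := Rmin_l d1 d2). assert (Hm2 := Rmin_r d1 d2).
  assert (0 < e) by (unfold e; repeat apply Rmin_glb_lt; lra).
  fold e in Hm, Hm'.
  destruct (H1 (a + e / 3) (b - e / 3)) as [p1 K1]; try lra.
  destruct (H2 (a + e / 3) (b - e / 3)) as [p2 K2]; try lra.
  rewrite <- RInt_Reals in K1, K2.
  set (v := RInt f (a + e / 3) (b - e / 3)) in *.
  assert (Rabs (I - J) <= Rabs (v - J) + Rabs (v - I)).
  { replace (I - J) with ((v - J) + - (v - I)) by ring.
    eapply Rle_trans; [apply Rabs_triang|]. rewrite Rabs_Ropp. lra. }
  lra.
Qed.

Lemma impint_eq (f : R -> R) (a b I : R) :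
  a < b -> improper_integral f a b I -> impint f a b = I.
Proof.
  intros Hab HI. apply improper_integral_unique with f a b; auto.
  unfold impint. apply epsilon_spec. now exists I.
Qed.

Lemma improper_integral_ext (f g : R -> R) (a b I : R) :
  (forall x, a < x < b -> f x = g x) ->
  improper_integral f a b I -> improper_integral g a b I.
Proof.
  intros Hfg HI eps He. destruct (HI eps He) as [d [Hd H]].
  exists d. split; [exact Hd|]. intros x y Hax Hx Hy Hyb Hxy.
  destruct (H x y Hax Hx Hy Hyb Hxy) as [pr Hpr].
  assert (Hext : forall s, Rmin x y < s < Rmax x y -> f s = g s).
  { intros s. rewrite Rmin_left, Rmax_right by lra. intros; apply Hfg; lra. }
  assert (pr' : Riemann_integrable g x y).
  { apply ex_RInt_Reals_0. apply (ex_RInt_ext f); [exact Hext|].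
    now apply ex_RInt_Reals_1. }
  exists pr'. rewrite <- RInt_Reals in *. now rewrite <- (RInt_ext f g) by exact Hext.
Qed.

Lemma is_RInt_reflect (f : R -> R) (x y : R) :
  ex_RInt f (- y) (- x) ->
  is_RInt (fun t => f (- t)) x y (RInt f (- y) (- x)).
Proof.
  intros pr.
  apply (RInt_correct (V := R_CompleteNormedModule)) in pr.
  apply (is_RInt_swap (V := R_NormedModule)) in pr.
  apply (is_RInt_comp_opp (V := R_NormedModule)) in pr.
  apply (is_RInt_opp (V := R_NormedModule)) in pr.
  rewrite opp_opp in pr. revert pr.
  apply is_RInt_ext. intros t _. unfold opp; simpl. ring.
Qed.

Lemma improper_integral_reflect (f : R -> R) (a b I : R) :
  improper_integral f a b I ->
  improper_integral (fun x => f (- x)) (- b) (- a) I.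
Proof.
  intros HI eps He. destruct (HI eps He) as [d [Hd H]].
  exists d. split; [exact Hd|]. intros x y Hax Hx Hy Hyb Hxy.
  destruct (H (- y) (- x)) as [pr Hpr]; try lra.
  rewrite <- RInt_Reals in Hpr.
  apply ex_RInt_Reals_1 in pr.
  assert (Hr := is_RInt_reflect f x y pr).
  assert (pr' : Riemann_integrable (fun t => f (- t)) x y).
  { apply ex_RInt_Reals_0. eexists; exact Hr. }
  exists pr'. rewrite <- RInt_Reals. now rewrite (is_RInt_unique _ _ _ _ Hr).
Qed.

Lemma bounded_of_continuous (k : R -> R) (p q : R) :
  p < q -> (forall x, continuous k x) ->
  exists B, 0 < B /\ forall x, p <= x <= q -> Rabs (k x) <= B.
Proof.
  intros Hpq Hk.
  destruct (continuity_ab_maj (fun x => Rabs (k x)) p q) as [M [HM _]]; [lra| |].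
  - intros c _. apply continuity_pt_filterlim.
    apply (continuous_comp k Rabs); [apply Hk|apply continuous_Rabs].
  - exists (Rabs (k M) + 1). split; [generalize (Rabs_pos (k M)); lra|].
    intros x Hx. specialize (HM x Hx). simpl in HM. lra.
Qed.

(** The derivative of [phi] may vanish at [p] and [q]; this is how endpoint singularities of [g] are
    absorbed into a continuous [k]. A proper integral of [g] over [[c, d]] pulls back to one of [k]
    over some [[x, y]], and what is missing from [[p, q]] are two short tails on which [k] is
    bounded. *)
Lemma improper_integral_subst (g phi dphi k : R -> R) (p q : R) :
  p < q ->
  (forall x, is_derive phi x (dphi x)) ->
  (forall x, continuous dphi x) ->
  (forall x, p < x < q -> 0 < dphi x) ->
  (forall z, phi p < z < phi q -> continuous g z) ->
  (forall x, continuous k x) ->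
  (forall x, p < x < q -> dphi x * g (phi x) = k x) ->
  improper_integral g (phi p) (phi q) (RInt k p q).
Proof.
  intros Hpq Hd Hdc Hpos Hg Hk Hkg.
  assert (Hmono : forall x y, p <= x -> x < y -> y <= q -> phi x < phi y).
  { intros x y Hx Hxy Hy.
    destruct (MVT_cor2 phi dphi x y Hxy) as [w [Hw [Hw1 Hw2]]].
    - intros; apply is_derive_Reals, Hd.
    - assert (0 < dphi w) by (apply Hpos; lra). nra. }
  assert (Hinv : forall z, phi p < z < phi q -> exists x, p < x < q /\ phi x = z).
  { intros z Hz.
    destruct (IVT_gen phi p q z) as [x [Hx Hxz]].
    - intros x. apply continuity_pt_filterlim.
      apply (ex_derive_continuous (V := R_NormedModule)). eexists; apply Hd.
    - rewrite Rmin_left, Rmax_right by lra. lra.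
    - rewrite Rmin_left, Rmax_right in Hx by lra.
      exists x. split; [|exact Hxz].
      destruct Hx as [[H1|H1] [H2|H2]]; subst; lra. }
  destruct (bounded_of_continuous k p q Hpq Hk) as [B [HB HkB]].
  intros eps He.
  (* Each tail has length below [e], so it contributes at most [e * B <= eps / 4]; the second bound
     keeps [p + e] and [q - e] inside [[p, q]]. *)
  set (e := Rmin (eps / (4 * B)) ((q - p) / 2)).
  assert (He0 : 0 < e).
  { unfold e. apply Rmin_glb_lt; [apply Rdiv_lt_0_compat; lra|lra]. }
  assert (He1 : e <= eps / (4 * B)) by apply Rmin_l.
  assert (He2 : e <= (q - p) / 2) by apply Rmin_r.
  assert (Hl : phi p < phi (p + e)) by (apply Hmono; lra).
  assert (Hr : phi (q - e) < phi q) by (apply Hmono; lra).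
  exists (Rmin (phi (p + e) - phi p) (phi q - phi (q - e))).
  split; [apply Rmin_glb_lt; lra|].
  intros c d Hc1 Hc2 Hd1 Hd2 Hcd.
  assert (Hm1 := Rmin_l (phi (p + e) - phi p) (phi q - phi (q - e))).
  assert (Hm2 := Rmin_r (phi (p + e) - phi p) (phi q - phi (q - e))).
  destruct (Hinv c) as [x [Hx Hxc]]; [lra|].
  destruct (Hinv d) as [y [Hy Hyd]]; [lra|].
  assert (Hxe : x < p + e).
  { apply Rnot_le_lt. intros Hle.
    assert (phi (p + e) <= phi x); [|lra].
    destruct Hle as [Hlt|<-]; [left; apply Hmono; lra|lra]. }
  assert (Hye : q - e < y).
  { apply Rnot_le_lt. intros Hle.
    assert (phi y <= phi (q - e)); [|lra].
    destruct Hle as [Hlt| ->]; [left; apply Hmono; lra|lra]. }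
  assert (Hxy : x < y).
  { apply Rnot_le_lt. intros [Hlt|Heq].
    - assert (phi y < phi x) by (apply Hmono; lra). lra.
    - subst y. lra. }
  assert (Hex : ex_RInt g c d).
  { apply (ex_RInt_continuous (V := R_CompleteNormedModule)).
    rewrite Rmin_left, Rmax_right by lra. intros z Hz. apply Hg; lra. }
  assert (pr : Riemann_integrable g c d) by now apply ex_RInt_Reals_0.
  exists pr. rewrite <- RInt_Reals.
  assert (Hsub : RInt k x y = RInt g c d).
  { rewrite <- Hxc, <- Hyd.
    rewrite <- (RInt_comp g phi dphi x y).
    - apply RInt_ext. rewrite Rmin_left, Rmax_right by lra. intros t Ht.
      symmetry. apply Hkg; lra.
    - rewrite Rmin_left, Rmax_right by lra. intros t Ht. apply Hg.
      split; apply Hmono; lra.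
    - intros t _. split; [apply Hd|apply Hdc]. }
  rewrite <- Hsub.
  assert (Hch : RInt k p q = RInt k p x + RInt k x y + RInt k y q).
  { rewrite <- (RInt_Chasles k p x q), <- (RInt_Chasles k x y q)
      by (apply ex_RInt_cont; exact Hk).
    unfold plus; simpl. ring. }
  rewrite Hch.
  assert (H1 : Rabs (RInt k p x) <= (x - p) * B).
  { apply abs_RInt_le_const; [lra|apply ex_RInt_cont, Hk|].
    intros; apply HkB; lra. }
  assert (H2 : Rabs (RInt k y q) <= (q - y) * B).
  { apply abs_RInt_le_const; [lra|apply ex_RInt_cont, Hk|].
    intros; apply HkB; lra. }
  replace (RInt k x y - (RInt k p x + RInt k x y + RInt k y q))
    with (- (RInt k p x + RInt k y q)) by ring.
  rewrite Rabs_Ropp. eapply Rle_lt_trans; [apply Rabs_triang|].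
  assert (e * B <= eps / 4).
  { replace (eps / 4) with (eps / (4 * B) * B) by (field; lra). nra. }
  nra.
Qed.

Lemma impint_proper (f : R -> R) (a b : R) :
  a < b -> (forall x, continuous f x) -> impint f a b = RInt f a b.
Proof.
  intros Hab Hf. apply impint_eq; [exact Hab|].
  apply (improper_integral_subst f (fun x => x) (fun _ => 1) f a b); auto; intros.
  - apply (is_derive_id (K := R_AbsRing)).
  - apply continuous_const.
  - lra.
  - ring.
Qed.

(** * The regularized kernels *)

(** An open condition invariant under [c -> - c], as the left outer interval requires. The bound on
    [2 * c], stronger than [be < t], makes the substitution on the outer interval strictly
    increasing. *)
Definition dom (c r t : R) : Prop :=
  0 < r /\ r < t /\ - r < c < r /\ - (t - r) < 2 * c < t - r.

Lemma dom_opp (c r t : R) : dom c r t -> dom (- c) r t.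
Proof. unfold dom; intros; lra. Qed.

Lemma dom_0 (r t : R) : 0 < r -> r < t -> dom 0 r t.
Proof. unfold dom; intros; lra. Qed.

Lemma sin2_eq (th : R) : sin th ^ 2 = 1 - cos th ^ 2.
Proof. generalize (sin2_cos2 th). unfold Rsqr. lra. Qed.

Lemma cos2_bound (th : R) : 0 <= cos th ^ 2 <= 1.
Proof.
  generalize (sin2_eq th) (pow2_ge_0 (sin th)) (pow2_ge_0 (cos th)). lra.
Qed.

Lemma sin2_bound (th : R) : 0 <= sin th ^ 2 <= 1.
Proof. generalize (sin2_eq th) (cos2_bound th). lra. Qed.

(** Chosen so that [zeta^2 - r^2 = (t^2 - r^2) sin^2] and [t^2 - zeta^2 = (t^2 - r^2) cos^2]: the
    square root zeros at both ends become a factor [sin * cos], which the differential cancels.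
    Adding [c cos^2] then moves the left end from [r] to [be] and leaves the right end at [t]. *)
Definition zeta (r t th : R) : R := sqrt (r ^ 2 * cos th ^ 2 + t ^ 2 * sin th ^ 2).

Lemma zeta_sqr (r t th : R) :
  zeta r t th ^ 2 = r ^ 2 * cos th ^ 2 + t ^ 2 * sin th ^ 2.
Proof.
  unfold zeta. apply pow2_sqrt.
  generalize (cos2_bound th) (sin2_bound th) (pow2_ge_0 r) (pow2_ge_0 t). nra.
Qed.

Lemma zeta_bound (r t th : R) : 0 < r < t -> r <= zeta r t th <= t.
Proof.
  intros H. generalize (zeta_sqr r t th) (cos2_bound th) (sin2_eq th).
  intros Hz Hc Hs. rewrite Hs in Hz.
  assert (0 <= zeta r t th) by apply sqrt_pos.
  assert (r ^ 2 < t ^ 2) by nra.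
  split; apply Rnot_lt_le; intros Hn; nra.
Qed.

(* For [z = zeta + c cos^2], which runs from [be] to [t] as [th] runs from 0 to
   [PI/2]: [z - be = sin^2 * P1], [t - z = cos^2 * P2], [z + al = P3],
   [t + z = P4], [z^2 + 4 = P5] and [dz = numW * sin * cos]. *)
Definition P1 (c r t th : R) := (t ^ 2 - r ^ 2) / (zeta r t th + r) - c.
Definition P2 (c r t th : R) := (t ^ 2 - r ^ 2) / (t + zeta r t th) - c.
Definition P3 (c r t th : R) := zeta r t th + r - c * sin th ^ 2.
Definition P4 (c r t th : R) := t + zeta r t th + c * cos th ^ 2.
Definition P5 (c r t th : R) := (zeta r t th + c * cos th ^ 2) ^ 2 + 4.

Lemma lt_div_of_bounds (k w x y d : R) :
  k < w -> 0 < w -> 0 < x <= y -> w * y <= d -> k < d / x.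
Proof. intros. apply Rlt_div_r; nra. Qed.

Lemma P1_pos c r t th : dom c r t -> 0 < P1 c r t th.
Proof.
  intros H. unfold dom in H. unfold P1.
  destruct (zeta_bound r t th) as [Hl Hu]; [lra|].
  cut (c < (t ^ 2 - r ^ 2) / (zeta r t th + r)); [lra|].
  apply (lt_div_of_bounds _ (t - r) _ (t + r)); nra.
Qed.

Lemma P2_pos c r t th : dom c r t -> 0 < P2 c r t th.
Proof.
  intros H. unfold dom in H. unfold P2.
  destruct (zeta_bound r t th) as [Hl Hu]; [lra|].
  cut (c < (t ^ 2 - r ^ 2) / (t + zeta r t th)); [lra|].
  apply (lt_div_of_bounds _ ((t - r) / 2) _ (t + t)); nra.
Qed.

Lemma P3_pos c r t th : dom c r t -> 0 < P3 c r t th.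
Proof.
  intros H. unfold dom in H. unfold P3.
  destruct (zeta_bound r t th) as [Hl Hu]; [lra|].
  generalize (sin2_bound th). nra.
Qed.

Lemma P4_pos c r t th : dom c r t -> 0 < P4 c r t th.
Proof.
  intros H. unfold dom in H. unfold P4.
  destruct (zeta_bound r t th) as [Hl Hu]; [lra|].
  generalize (cos2_bound th). nra.
Qed.

Lemma P5_pos c r t th : 0 < P5 c r t th.
Proof.
  unfold P5. generalize (pow2_ge_0 (zeta r t th + c * cos th ^ 2)). lra.
Qed.

Definition radW (c r t th : R) : R :=
  P1 c r t th * P2 c r t th * P3 c r t th * P4 c r t th * P5 c r t th.

Lemma radW_pos c r t th : dom c r t -> 0 < radW c r t th.
Proof.
  intros H. unfold radW.
  repeat apply Rmult_lt_0_compat;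
    auto using P1_pos, P2_pos, P3_pos, P4_pos, P5_pos.
Qed.

Definition numW (c r t th : R) : R := (t ^ 2 - r ^ 2) / zeta r t th - 2 * c.

Lemma numW_pos c r t th : dom c r t -> 0 < numW c r t th.
Proof.
  intros H. unfold dom in H. unfold numW.
  destruct (zeta_bound r t th) as [Hl Hu]; [lra|].
  cut (2 * c < (t ^ 2 - r ^ 2) / zeta r t th); [lra|].
  apply (lt_div_of_bounds _ (t - r) _ t); nra.
Qed.

Definition W (c r t th : R) : R := numW c r t th / sqrt (radW c r t th).

(* [radW c - radW (- c) = c * radW_diff c], factor by factor. *)
Definition radW_diff (c r t th : R) : R :=
  - 2 * P2 c r t th * P3 c r t th * P4 c r t th * P5 c r t th
  + P1 (- c) r t th * (- 2) * P3 c r t th * P4 c r t th * P5 c r t th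
  + P1 (- c) r t th * P2 (- c) r t th * (- 2 * sin th ^ 2)
    * P4 c r t th * P5 c r t th
  + P1 (- c) r t th * P2 (- c) r t th * P3 (- c) r t th * (2 * cos th ^ 2)
    * P5 c r t th
  + P1 (- c) r t th * P2 (- c) r t th * P3 (- c) r t th * P4 (- c) r t th
    * (4 * zeta r t th * cos th ^ 2).

Lemma radW_diffE c r t th :
  radW c r t th - radW (- c) r t th = c * radW_diff c r t th.
Proof. unfold radW, radW_diff, P1, P2, P3, P4, P5. ring. Qed.

Lemma inv_sqrt_diff (p q : R) : 0 < p -> 0 < q ->
  / sqrt p - / sqrt q = - (p - q) / (sqrt p * sqrt q * (sqrt p + sqrt q)).
Proof.
  intros Hp Hq.
  assert (0 < sqrt p) by now apply sqrt_lt_R0.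
  assert (0 < sqrt q) by now apply sqrt_lt_R0.
  replace (p - q) with (sqrt p ^ 2 - sqrt q ^ 2) by (rewrite !pow2_sqrt; lra).
  field. repeat split; lra.
Qed.

(* The quotient [(W c - W (- c)) / c], extended continuously to [c = 0]. *)
Definition Wquot (c r t th : R) : R :=
  - 4 / sqrt (radW c r t th)
  - numW (- c) r t th * radW_diff c r t th
    / (sqrt (radW c r t th) * sqrt (radW (- c) r t th)
       * (sqrt (radW c r t th) + sqrt (radW (- c) r t th))).

(** The numerator changes by [numW c = numW (- c) - 4 c], which gives the first term of [Wquot]; the
    difference of the inverse roots gives the second. *)
Lemma WquotE c r t th : dom c r t ->
  W c r t th - W (- c) r t th = c * Wquot c r t th.
Proof.
  intros H.
  assert (Hp := radW_pos c r t th H).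
  assert (Hq := radW_pos (- c) r t th (dom_opp _ _ _ H)).
  assert (Hd := inv_sqrt_diff _ _ Hp Hq). rewrite radW_diffE in Hd.
  unfold W, Wquot.
  replace (numW c r t th) with (numW (- c) r t th - 4 * c) by (unfold numW; ring).
  replace ((numW (- c) r t th - 4 * c) / sqrt (radW c r t th)
           - numW (- c) r t th / sqrt (radW (- c) r t th))
    with (numW (- c) r t th * (/ sqrt (radW c r t th) - / sqrt (radW (- c) r t th))
          + c * (- 4 / sqrt (radW c r t th))) by (unfold Rdiv; ring).
  rewrite Hd. unfold Rdiv. ring.
Qed.

(* On [(- al, be)] put [z = c + yv]; then [dz / sqrt (r^2 - yv^2) = jac], and at
   [c = 0] the integrand becomes the one of [ellK m2]. *)
Definition qv (r th : R) : R := r ^ 2 + 4 - r ^ 2 * sin th ^ 2.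
Definition jac (r th : R) : R := 2 * sqrt (r ^ 2 + 4) / qv r th.
Definition yv (r th : R) : R := 2 * r * sin th / sqrt (qv r th).

Lemma qv_ge (r th : R) : 4 <= qv r th.
Proof. unfold qv. generalize (sin2_bound th) (pow2_ge_0 r). nra. Qed.

Lemma sqrt_qv_pos (r th : R) : 0 < sqrt (qv r th).
Proof. apply sqrt_lt_R0. generalize (qv_ge r th); lra. Qed.

Lemma jac_pos (r th : R) : 0 < jac r th.
Proof.
  unfold jac. apply Rdiv_lt_0_compat; [|generalize (qv_ge r th); lra].
  apply Rmult_lt_0_compat; [lra|apply sqrt_lt_R0].
  generalize (pow2_ge_0 r); lra.
Qed.

Lemma yv_sqr (r th : R) : yv r th ^ 2 = 4 * r ^ 2 * sin th ^ 2 / qv r th.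
Proof.
  assert (H := qv_ge r th). unfold yv.
  rewrite <- (pow2_sqrt (qv r th)) at 2 by lra. field.
  generalize (sqrt_qv_pos r th); lra.
Qed.

Lemma sqr_sub_yv (r th : R) :
  r ^ 2 - yv r th ^ 2 = r ^ 2 * (r ^ 2 + 4) * cos th ^ 2 / qv r th.
Proof.
  rewrite yv_sqr. assert (H := qv_ge r th).
  replace (cos th ^ 2) with (1 - sin th ^ 2) by (rewrite sin2_eq; ring).
  assert (qv r th = r ^ 2 + 4 - r ^ 2 * sin th ^ 2) by reflexivity.
  apply (Rmult_eq_reg_r (qv r th)); [|lra].
  field_simplify; [|lra|lra]. rewrite H0. ring.
Qed.

Lemma yv_bound (r th : R) : 0 < r -> - r <= yv r th <= r.
Proof.
  intros Hr.
  assert (0 <= r ^ 2 - yv r th ^ 2).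
  { rewrite sqr_sub_yv. apply Rdiv_le_0_compat; [|generalize (qv_ge r th); lra].
    generalize (cos2_bound th) (pow2_ge_0 r). intros.
    apply Rmult_le_pos; [apply Rmult_le_pos|]; lra. }
  nra.
Qed.

Definition radh (t z : R) : R := (t ^ 2 - z ^ 2) * (z ^ 2 + 4).
Definition hker (t z : R) : R := / sqrt (radh t z).

Lemma radh_pos (t z : R) : - t < z < t -> 0 < radh t z.
Proof. intros H. unfold radh. apply Rmult_lt_0_compat; nra. Qed.

Lemma yv_dom c r t th : dom c r t -> - t < yv r th + c < t.
Proof.
  intros H; unfold dom in H. generalize (yv_bound r th). lra.
Qed.

Lemma yv_dom' c r t th : dom c r t -> - t < yv r th - c < t.
Proof. intros H. apply (yv_dom (- c)). now apply dom_opp. Qed.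

(* The quotient [(hker t (y + c) - hker t (y - c)) / c], extended to [c = 0]. *)
Definition hquot (c t y : R) : R :=
  - (4 * y * (t ^ 2 - 4 - 2 * y ^ 2 - 2 * c ^ 2))
  / (sqrt (radh t (y + c)) * sqrt (radh t (y - c))
     * (sqrt (radh t (y + c)) + sqrt (radh t (y - c)))).

Lemma hquotE c t y : - t < y + c < t -> - t < y - c < t ->
  hker t (y + c) - hker t (y - c) = c * hquot c t y.
Proof.
  intros H1 H2. unfold hker, hquot.
  rewrite inv_sqrt_diff by now apply radh_pos.
  replace (radh t (y + c) - radh t (y - c))
    with (c * (4 * y * (t ^ 2 - 4 - 2 * y ^ 2 - 2 * c ^ 2)))
    by (unfold radh; ring).
  unfold Rdiv. ring.
Qed.

(** Stated along arbitrary continuous maps from a uniform space, so that the same fact serves for a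
    kernel as a function of the angle alone, for parameter integrals over [U * R], and for curves in
    the parameter space. *)
Definition jointly_continuous (K : R -> R -> R -> R -> R) : Prop :=
  forall (U : UniformSpace) (c r t th : U -> R) (x : U),
  continuous c x -> continuous r x -> continuous t x -> continuous th x ->
  dom (c x) (r x) (t x) -> continuous (fun u => K (c u) (r u) (t u) (th u)) x.

Lemma jc_const_th (K : R -> R -> R -> R -> R) c r t :
  jointly_continuous K -> dom c r t -> forall x, continuous (K c r t) x.
Proof.
  intros HK Hd x.
  apply (HK R_UniformSpace (fun _ => c) (fun _ => r) (fun _ => t) (fun s => s));
    [apply continuous_const.. | apply continuous_id | exact Hd].
Qed.

Lemma locally_pos {U : UniformSpace} (f : U -> R) (x : U) :
  continuous f x -> 0 < f x -> locally x (fun u => 0 < f u).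
Proof.
  intros Hf Hx. apply (Hf (fun y => 0 < y)).
  exists (mkposreal _ Hx). intros y Hy. apply Rabs_lt_between' in Hy.
  simpl in Hy. lra.
Qed.

Lemma locally_dom {U : UniformSpace} (c r t : U -> R) (x : U) :
  continuous c x -> continuous r x -> continuous t x ->
  dom (c x) (r x) (t x) -> locally x (fun u => dom (c u) (r u) (t u)).
Proof.
  intros Hc Hr Ht H. unfold dom in H.
  assert (L1 := locally_pos r x Hr (proj1 H)).
  assert (L2 : locally x (fun u => 0 < t u - r u)).
  { apply (locally_pos (fun u => t u - r u)); [cont|lra]. }
  assert (L3 : locally x (fun u => 0 < r u - c u)).
  { apply (locally_pos (fun u => r u - c u)); [cont|lra]. }
  assert (L4 : locally x (fun u => 0 < r u + c u)).
  { apply (locally_pos (fun u => r u + c u)); [cont|lra]. }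
  assert (L5 : locally x (fun u => 0 < t u - r u - 2 * c u)).
  { apply (locally_pos (fun u => t u - r u - 2 * c u)); [cont|lra]. }
  assert (L6 : locally x (fun u => 0 < t u - r u + 2 * c u)).
  { apply (locally_pos (fun u => t u - r u + 2 * c u)); [cont|lra]. }
  generalize (filter_and _ _ L1 (filter_and _ _ L2 (filter_and _ _ L3
    (filter_and _ _ L4 (filter_and _ _ L5 L6))))).
  apply filter_imp. intros u. unfold dom. lra.
Qed.

Lemma continuous_RInt_jc (K : R -> R -> R -> R -> R) :
  jointly_continuous K ->
  forall (U : UniformSpace) (c r t : U -> R) (x : U),
  continuous c x -> continuous r x -> continuous t x ->
  dom (c x) (r x) (t x) ->
  continuous (fun u => RInt (K (c u) (r u) (t u)) 0 (PI / 2)) x.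
Proof.
  intros HK U c r t x Hc Hr Ht Hd.
  apply (continuous_RInt_param (fun u => K (c u) (r u) (t u))).
  - generalize PI_RGT_0; lra.
  - intros s.
    assert (Hf : forall f : U -> R, continuous f x ->
                 continuous (fun p : U * R => f (fst p)) (x, s)).
    { intros f Hf. apply (continuous_comp fst f); [apply continuous_fst|exact Hf]. }
    apply (HK _ (fun p : U * R => c (fst p)) (fun p => r (fst p))
      (fun p => t (fst p)) snd); auto.
    apply continuous_snd.
  - generalize (locally_dom c r t x Hc Hr Ht Hd). apply filter_imp.
    intros u Hu s. now apply jc_const_th.
Qed.

Lemma continuous_zeta {U : UniformSpace} (r t th : U -> R) (x : U) :
  continuous r x -> continuous t x -> continuous th x ->
  continuous (fun u => zeta (r u) (t u) (th u)) x.
Proof. intros. unfold zeta. cont. Qed.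

Lemma jc_P1 : jointly_continuous P1.
Proof.
  intros U c r t th x Hc Hr Ht Hth Hd. unfold P1.
  assert (Hz := continuous_zeta r t th x Hr Ht Hth). cont.
  unfold dom in Hd. generalize (zeta_bound (r x) (t x) (th x)). lra.
Qed.

Lemma jc_P2 : jointly_continuous P2.
Proof.
  intros U c r t th x Hc Hr Ht Hth Hd. unfold P2.
  assert (Hz := continuous_zeta r t th x Hr Ht Hth). cont.
  unfold dom in Hd. generalize (zeta_bound (r x) (t x) (th x)). lra.
Qed.

Lemma jc_P3 : jointly_continuous P3.
Proof.
  intros U c r t th x Hc Hr Ht Hth Hd. unfold P3.
  assert (Hz := continuous_zeta r t th x Hr Ht Hth). cont.
Qed.

Lemma jc_P4 : jointly_continuous P4.
Proof.
  intros U c r t th x Hc Hr Ht Hth Hd. unfold P4.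
  assert (Hz := continuous_zeta r t th x Hr Ht Hth). cont.
Qed.

Lemma jc_P5 : jointly_continuous P5.
Proof.
  intros U c r t th x Hc Hr Ht Hth Hd. unfold P5.
  assert (Hz := continuous_zeta r t th x Hr Ht Hth). cont.
Qed.

Lemma jc_numW : jointly_continuous numW.
Proof.
  intros U c r t th x Hc Hr Ht Hth Hd. unfold numW.
  assert (Hz := continuous_zeta r t th x Hr Ht Hth). cont.
  unfold dom in Hd. generalize (zeta_bound (r x) (t x) (th x)). lra.
Qed.

Lemma jc_opp (K : R -> R -> R -> R -> R) :
  jointly_continuous K -> jointly_continuous (fun c => K (- c)).
Proof.
  intros HK U c r t th x Hc Hr Ht Hth Hd.
  apply (HK U (fun u => - c u)); auto; [cont | now apply dom_opp].
Qed.

Lemma jc_radW : jointly_continuous radW.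
Proof.
  intros U c r t th x Hc Hr Ht Hth Hd. unfold radW.
  assert (H1 := jc_P1 U c r t th x Hc Hr Ht Hth Hd).
  assert (H2 := jc_P2 U c r t th x Hc Hr Ht Hth Hd).
  assert (H3 := jc_P3 U c r t th x Hc Hr Ht Hth Hd).
  assert (H4 := jc_P4 U c r t th x Hc Hr Ht Hth Hd).
  assert (H5 := jc_P5 U c r t th x Hc Hr Ht Hth Hd).
  cont.
Qed.

Lemma jc_radW_diff : jointly_continuous radW_diff.
Proof.
  intros U c r t th x Hc Hr Ht Hth Hd. unfold radW_diff.
  assert (H1 := jc_P1 U c r t th x Hc Hr Ht Hth Hd).
  assert (H2 := jc_P2 U c r t th x Hc Hr Ht Hth Hd).
  assert (H3 := jc_P3 U c r t th x Hc Hr Ht Hth Hd).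
  assert (H4 := jc_P4 U c r t th x Hc Hr Ht Hth Hd).
  assert (H5 := jc_P5 U c r t th x Hc Hr Ht Hth Hd).
  assert (H1' := jc_opp _ jc_P1 U c r t th x Hc Hr Ht Hth Hd).
  assert (H2' := jc_opp _ jc_P2 U c r t th x Hc Hr Ht Hth Hd).
  assert (H3' := jc_opp _ jc_P3 U c r t th x Hc Hr Ht Hth Hd).
  assert (H4' := jc_opp _ jc_P4 U c r t th x Hc Hr Ht Hth Hd).
  assert (Hz := continuous_zeta r t th x Hr Ht Hth).
  cont.
Qed.

Lemma sqrt_radW_pos c r t th : dom c r t -> 0 < sqrt (radW c r t th).
Proof. intros. now apply sqrt_lt_R0, radW_pos. Qed.

Lemma jc_W : jointly_continuous W.
Proof.
  intros U c r t th x Hc Hr Ht Hth Hd. unfold W.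
  assert (H1 := jc_numW U c r t th x Hc Hr Ht Hth Hd).
  assert (H2 := jc_radW U c r t th x Hc Hr Ht Hth Hd).
  cont. apply Rgt_not_eq, sqrt_radW_pos, Hd.
Qed.

Lemma jc_Wquot : jointly_continuous Wquot.
Proof.
  intros U c r t th x Hc Hr Ht Hth Hd. unfold Wquot.
  assert (H1 := jc_opp _ jc_numW U c r t th x Hc Hr Ht Hth Hd).
  assert (H2 := jc_radW U c r t th x Hc Hr Ht Hth Hd).
  assert (H3 := jc_opp _ jc_radW U c r t th x Hc Hr Ht Hth Hd).
  assert (H4 := jc_radW_diff U c r t th x Hc Hr Ht Hth Hd).
  assert (S1 := sqrt_radW_pos _ _ _ (th x) Hd).
  assert (S2 := sqrt_radW_pos _ _ _ (th x) (dom_opp _ _ _ Hd)).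
  cont.
  - lra.
  - apply Rgt_not_eq. repeat apply Rmult_lt_0_compat; lra.
Qed.

Lemma continuous_jac {U : UniformSpace} (r th : U -> R) (x : U) :
  continuous r x -> continuous th x -> continuous (fun u => jac (r u) (th u)) x.
Proof.
  intros. unfold jac, qv. cont.
  change (qv (r x) (th x) <> 0). generalize (qv_ge (r x) (th x)). lra.
Qed.

Lemma continuous_yv {U : UniformSpace} (r th : U -> R) (x : U) :
  continuous r x -> continuous th x -> continuous (fun u => yv (r u) (th u)) x.
Proof.
  intros. unfold yv, qv. cont.
  change (sqrt (qv (r x) (th x)) <> 0). generalize (sqrt_qv_pos (r x) (th x)). lra.
Qed.

Lemma continuous_hker {U : UniformSpace} (t z : U -> R) (x : U) :
  continuous t x -> continuous z x -> - t x < z x < t x ->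
  continuous (fun u => hker (t u) (z u)) x.
Proof.
  intros Ht Hz H. unfold hker, radh. cont.
  change (sqrt (radh (t x) (z x)) <> 0).
  apply Rgt_not_eq. now apply sqrt_lt_R0, radh_pos.
Qed.

Definition kerA0 (c r t th : R) : R :=
  jac r th * (hker t (yv r th + c) + hker t (yv r th - c)).
Definition kerA1 (c r t th : R) : R := jac r th * (yv r th * hquot c t (yv r th)).
Definition kerB1 (c r t th : R) : R :=
  (zeta r t th - c * sin th ^ 2) * W c r t th
  + (zeta r t th + c * sin th ^ 2) * W (- c) r t th.

Lemma jc_kerA0 : jointly_continuous kerA0.
Proof.
  intros U c r t th x Hc Hr Ht Hth Hd. unfold kerA0.
  assert (H1 := continuous_jac r th x Hr Hth).
  assert (H2 := continuous_yv r th x Hr Hth).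
  assert (H3 := continuous_hker t (fun u => yv (r u) (th u) + c u) x Ht
     ltac:(cont) (yv_dom _ _ _ _ Hd)).
  assert (H4 := continuous_hker t (fun u => yv (r u) (th u) - c u) x Ht
     ltac:(cont) (yv_dom' _ _ _ _ Hd)).
  cont.
Qed.

Lemma jc_kerA1 : jointly_continuous kerA1.
Proof.
  intros U c r t th x Hc Hr Ht Hth Hd. unfold kerA1, hquot, radh.
  assert (H1 := continuous_jac r th x Hr Hth).
  assert (H2 := continuous_yv r th x Hr Hth).
  cont. apply Rgt_not_eq.
  assert (S1 := sqrt_lt_R0 _ (radh_pos _ _ (yv_dom _ _ _ (th x) Hd))).
  assert (S2 := sqrt_lt_R0 _ (radh_pos _ _ (yv_dom' _ _ _ (th x) Hd))).
  unfold radh in S1, S2. repeat apply Rmult_lt_0_compat; lra.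
Qed.

Lemma jc_kerB1 : jointly_continuous kerB1.
Proof.
  intros U c r t th x Hc Hr Ht Hth Hd. unfold kerB1.
  assert (Hz := continuous_zeta r t th x Hr Ht Hth).
  assert (H1 := jc_W U c r t th x Hc Hr Ht Hth Hd).
  assert (H2 := jc_opp _ jc_W U c r t th x Hc Hr Ht Hth Hd).
  cont.
Qed.

(** All four are even in [c]. With [s = 1] for [g1] and [s = -1] for [g2], the middle period will be
    [r A0 + s c A1] up to the sign-free normalization of [inner], and the sum of the two outer
    periods [B1 + s r c B0]; [M] is the determinant left after cross multiplication. *)
Definition intA0 (c r t : R) : R := RInt (kerA0 c r t) 0 (PI / 2).
Definition intA1 (c r t : R) : R := RInt (kerA1 c r t) 0 (PI / 2).
Definition intB0 (c r t : R) : R := RInt (Wquot c r t) 0 (PI / 2).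
Definition intB1 (c r t : R) : R := RInt (kerB1 c r t) 0 (PI / 2).
Definition M (c r t : R) : R :=
  r ^ 2 * intA0 c r t * intB0 c r t - intA1 c r t * intB1 c r t.

Lemma continuous_M {U : UniformSpace} (c r t : U -> R) (x : U) :
  continuous c x -> continuous r x -> continuous t x ->
  dom (c x) (r x) (t x) -> continuous (fun u => M (c u) (r u) (t u)) x.
Proof.
  intros Hc Hr Ht Hd. unfold M.
  assert (H1 := continuous_RInt_jc _ jc_kerA0 U c r t x Hc Hr Ht Hd).
  assert (H2 := continuous_RInt_jc _ jc_kerA1 U c r t x Hc Hr Ht Hd).
  assert (H3 := continuous_RInt_jc _ jc_Wquot U c r t x Hc Hr Ht Hd).
  assert (H4 := continuous_RInt_jc _ jc_kerB1 U c r t x Hc Hr Ht Hd).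
  unfold intA0, intA1, intB0, intB1. cont.
Qed.

(** * The periods as regular integrals *)

Lemma sqrt_neq_0 (x : R) : 0 < x -> sqrt x <> 0.
Proof. intros H. apply Rgt_not_eq. now apply sqrt_lt_R0. Qed.

Lemma continuous_g1 al be t z :
  - t < z < t -> z <> - al -> z <> be -> continuous (g1 al be t) z.
Proof.
  intros H1 H2 H3. unfold g1. cont.
  - apply sqrt_neq_0, Rabs_pos_lt. lra.
  - apply sqrt_neq_0. nra.
  - apply sqrt_neq_0. nra.
Qed.

Lemma continuous_g2 al be t z :
  - t < z < t -> z <> - al -> z <> be -> continuous (g2 al be t) z.
Proof.
  intros H1 H2 H3. unfold g2. cont.
  - apply sqrt_neq_0, Rabs_pos_lt. lra.
  - apply sqrt_neq_0. nra.
  - apply sqrt_neq_0. nra.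
Qed.

Lemma g1_reflect al be t z : g1 al be t (- z) = g2 be al t z.
Proof.
  unfold g1, g2.
  replace (Rabs (- z + al)) with (Rabs (z - al))
    by (rewrite <- Rabs_Ropp; f_equal; ring).
  replace (Rabs (- z - be)) with (Rabs (z + be))
    by (rewrite <- Rabs_Ropp; f_equal; ring).
  replace ((- z) ^ 2) with (z ^ 2) by ring. reflexivity.
Qed.

Lemma g2_reflect al be t z : g2 al be t (- z) = g1 be al t z.
Proof. rewrite <- (g1_reflect be al), Ropp_involutive. reflexivity. Qed.

(** * Periods over the two outer intervals *)

Lemma is_derive_zeta (r t x : R) : 0 < r < t ->
  is_derive (zeta r t) x ((t ^ 2 - r ^ 2) / zeta r t x * (sin x * cos x)).
Proof.
  intros H. destruct (zeta_bound r t x H) as [Hl _].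
  assert (Hz : 0 < r ^ 2 * cos x ^ 2 + t ^ 2 * sin x ^ 2)
    by (rewrite <- zeta_sqr; nra).
  unfold zeta in *. auto_derive.
  - simpl in Hz. lra.
  - simpl in *. field. lra.
Qed.

Definition zsub (c r t th : R) : R := zeta r t th + c * cos th ^ 2.

Lemma is_derive_zsub c r t x : 0 < r < t ->
  is_derive (zsub c r t) x (numW c r t x * (sin x * cos x)).
Proof.
  intros H. unfold zsub, numW.
  replace (((t ^ 2 - r ^ 2) / zeta r t x - 2 * c) * (sin x * cos x))
    with ((t ^ 2 - r ^ 2) / zeta r t x * (sin x * cos x)
          + c * (2 * (- sin x) * cos x)) by (unfold Rdiv; ring).
  apply (is_derive_plus (K := R_AbsRing) (V := R_NormedModule)).
  - now apply is_derive_zeta.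
  - auto_derive; [easy|ring].
Qed.

(** Rationalizing, [zeta - r = (zeta^2 - r^2) / (zeta + r)], exposes the factor [sin^2]; the
    remainder is [c cos^2 - c = - c sin^2]. *)
Lemma zsub_be c r t th : 0 < r < t ->
  zsub c r t th - (r + c) = sin th ^ 2 * P1 c r t th.
Proof.
  intros H. unfold zsub, P1. destruct (zeta_bound r t th H) as [Hl Hu].
  assert (Hz := zeta_sqr r t th).
  replace (cos th ^ 2) with (1 - sin th ^ 2) in * by (rewrite sin2_eq; ring).
  apply (Rmult_eq_reg_r (zeta r t th + r)); [|lra].
  field_simplify; [|lra]. nra.
Qed.

Lemma zsub_tau c r t th : 0 < r < t ->
  t - zsub c r t th = cos th ^ 2 * P2 c r t th.
Proof.
  intros H. unfold zsub, P2. destruct (zeta_bound r t th H) as [Hl Hu].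
  assert (Hz := zeta_sqr r t th). rewrite sin2_eq in Hz.
  apply (Rmult_eq_reg_r (t + zeta r t th)); [|lra].
  field_simplify; [|lra]. nra.
Qed.

Lemma zsub_al c r t th : zsub c r t th + (r - c) = P3 c r t th.
Proof. unfold zsub, P3. rewrite sin2_eq. ring. Qed.

Lemma zsub_0 c r t : 0 < r < t -> zsub c r t 0 = r + c.
Proof.
  intros H. generalize (zsub_be c r t 0 H). rewrite sin_0. intros. nra.
Qed.

Lemma zsub_PI2 c r t : 0 < r < t -> zsub c r t (PI / 2) = t.
Proof.
  intros H. generalize (zsub_tau c r t (PI / 2) H). rewrite cos_PI2. intros. nra.
Qed.

Lemma sqrt_radW c r t th : dom c r t ->
  sqrt (radW c r t th) = sqrt (P1 c r t th) * sqrt (P2 c r t th)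
    * sqrt (P3 c r t th) * sqrt (P4 c r t th) * sqrt (P5 c r t th).
Proof.
  intros H.
  assert (H1 := P1_pos c r t th H). assert (H2 := P2_pos c r t th H).
  assert (H3 := P3_pos c r t th H). assert (H4 := P4_pos c r t th H).
  unfold radW.
  rewrite !sqrt_mult_alt; try reflexivity;
    repeat apply Rmult_le_pos; lra.
Qed.

Lemma sqrt_sqr_mult (s x : R) : 0 <= s -> sqrt (s ^ 2 * x) = s * sqrt x.
Proof. intros H. rewrite sqrt_mult_alt by apply pow2_ge_0. now rewrite sqrt_pow2. Qed.

Lemma sqrt_tau_zsub c r t th : dom c r t -> 0 <= cos th ->
  sqrt (t ^ 2 - zsub c r t th ^ 2)
  = cos th * sqrt (P2 c r t th) * sqrt (P4 c r t th).
Proof.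
  intros H Hk. assert (H' := H). unfold dom in H.
  replace (t ^ 2 - zsub c r t th ^ 2)
    with (cos th ^ 2 * (P2 c r t th * P4 c r t th)).
  - rewrite sqrt_sqr_mult, sqrt_mult_alt by
      (auto; left; now apply P2_pos). ring.
  - replace (t ^ 2 - zsub c r t th ^ 2)
      with ((t - zsub c r t th) * (t + zsub c r t th)) by ring.
    rewrite zsub_tau by lra. unfold P4, zsub. ring.
Qed.

Lemma sin_cos_pos x : 0 < x < PI / 2 -> 0 < sin x /\ 0 < cos x.
Proof.
  intros H. generalize PI_RGT_0. intros.
  split; [apply sin_gt_0 | apply cos_gt_0]; lra.
Qed.

(** To the right of [be], [g1] and [g2] are [z + al] and [z - be] divided by the same square root.
    The first factor here is [z + al] for [s = 1] and [z - be] for [s = -1], and [W] is the common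
    remainder times [dz], without singularities. *)
Definition outer (s : R) (c r t th : R) : R :=
  (zeta r t th - c * sin th ^ 2 + s * r) * W c r t th.

Lemma jc_outer s : jointly_continuous (outer s).
Proof.
  intros U c r t th x Hc Hr Ht Hth Hd. unfold outer.
  assert (Hz := continuous_zeta r t th x Hr Ht Hth).
  assert (H1 := jc_W U c r t th x Hc Hr Ht Hth Hd).
  cont.
Qed.

Lemma outer_g (s : R) (g : R -> R) c r t : dom c r t ->
  (forall z, r + c < z < t -> continuous g z) ->
  (forall x, 0 < sin x -> 0 < cos x ->
     numW c r t x * (sin x * cos x) * g (zsub c r t x) = outer s c r t x) ->
  improper_integral g (r + c) t (RInt (outer s c r t) 0 (PI / 2)).
Proof.
  intros H Hg Hgx. assert (H' := H). unfold dom in H'.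
  assert (E1 := zsub_0 c r t ltac:(lra)). assert (E2 := zsub_PI2 c r t ltac:(lra)).
  enough (improper_integral g (zsub c r t 0) (zsub c r t (PI / 2))
    (RInt (outer s c r t) 0 (PI / 2))) as Hi by now rewrite E1, E2 in Hi.
  apply improper_integral_subst with (fun x => numW c r t x * (sin x * cos x)).
  - generalize PI_RGT_0; lra.
  - intros x. apply is_derive_zsub; lra.
  - intros x. assert (Hn := jc_const_th _ c r t jc_numW H x). cont.
  - intros x Hx. destruct (sin_cos_pos x Hx).
    repeat apply Rmult_lt_0_compat; auto. now apply numW_pos.
  - rewrite E1, E2. exact Hg.
  - exact (jc_const_th _ c r t (jc_outer s) H).
  - intros x Hx. destruct (sin_cos_pos x Hx) as [Hs Hk]. auto.
Qed.

Lemma outer_g1 c r t : dom c r t ->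
  improper_integral (g1 (r - c) (r + c) t) (r + c) t
    (RInt (outer 1 c r t) 0 (PI / 2)).
Proof.
  intros H. assert (H' := H). unfold dom in H'. apply outer_g; [exact H| |].
  - intros z Hz. apply continuous_g1; lra.
  - intros x Hs Hk.
    assert (R1 := P1_pos c r t x H). assert (R2 := P2_pos c r t x H).
    assert (R3 := P3_pos c r t x H). assert (R4 := P4_pos c r t x H).
    assert (R5 := P5_pos c r t x).
    unfold g1, outer, W. rewrite sqrt_radW by auto.
    rewrite zsub_al, zsub_be by lra.
    rewrite sqrt_tau_zsub by (auto; lra).
    change (zsub c r t x ^ 2 + 4) with (P5 c r t x).
    rewrite !Rabs_pos_eq by nra. rewrite sqrt_sqr_mult by lra.
    replace (zeta r t x - c * sin x ^ 2 + 1 * r) with (sqrt (P3 c r t x) ^ 2)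
      by (rewrite pow2_sqrt by lra; unfold P3; ring).
    field. repeat split; try (apply sqrt_neq_0; assumption); lra.
Qed.

Lemma outer_g2 c r t : dom c r t ->
  improper_integral (g2 (r - c) (r + c) t) (r + c) t
    (RInt (outer (-1) c r t) 0 (PI / 2)).
Proof.
  intros H. assert (H' := H). unfold dom in H'. apply outer_g; [exact H| |].
  - intros z Hz. apply continuous_g2; lra.
  - intros x Hs Hk.
    assert (R1 := P1_pos c r t x H). assert (R2 := P2_pos c r t x H).
    assert (R3 := P3_pos c r t x H). assert (R4 := P4_pos c r t x H).
    assert (R5 := P5_pos c r t x).
    unfold g2, outer, W. rewrite sqrt_radW by auto.
    rewrite zsub_al, zsub_be by lra.
    rewrite sqrt_tau_zsub by (auto; lra).
    change (zsub c r t x ^ 2 + 4) with (P5 c r t x).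
    rewrite !Rabs_pos_eq by nra. rewrite sqrt_sqr_mult by lra.
    replace (zeta r t x - c * sin x ^ 2 + -1 * r)
      with (sin x ^ 2 * sqrt (P1 c r t x) ^ 2)
      by (rewrite pow2_sqrt by lra; rewrite <- zsub_be by lra; unfold zsub;
          rewrite sin2_eq; ring).
    field. repeat split; try (apply sqrt_neq_0; assumption); lra.
Qed.

(** The reflection [z -> - z] exchanges [g1] with [g2] as well as [al] with [be], so both [s] and
    [c] change sign. *)
Lemma outer_left_g1 c r t : dom c r t ->
  improper_integral (g1 (r - c) (r + c) t) (- t) (- (r - c))
    (RInt (outer (-1) (- c) r t) 0 (PI / 2)).
Proof.
  intros H. assert (Ho := outer_g2 (- c) r t (dom_opp _ _ _ H)).
  apply improper_integral_reflect in Ho.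
  revert Ho. replace (r - - c) with (r + c) by ring.
  replace (r + - c) with (r - c) by ring.
  apply improper_integral_ext. intros x _. apply g2_reflect.
Qed.

Lemma outer_left_g2 c r t : dom c r t ->
  improper_integral (g2 (r - c) (r + c) t) (- t) (- (r - c))
    (RInt (outer 1 (- c) r t) 0 (PI / 2)).
Proof.
  intros H. assert (Ho := outer_g1 (- c) r t (dom_opp _ _ _ H)).
  apply improper_integral_reflect in Ho.
  revert Ho. replace (r - - c) with (r + c) by ring.
  replace (r + - c) with (r - c) by ring.
  apply improper_integral_ext. intros x _. apply g1_reflect.
Qed.

(** In the middle, with [z = c + y], one has [z + al = r + y] and [be - z = r - y]. So [g1] and [g2]
    are [r + y] and [r - y], that is [r + s y], over a common root whose factor [sqrt (r^2 - y^2)]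
    is cancelled by [dy]. *)
Definition inner (s : R) (c r t th : R) : R :=
  jac r th * (r + s * yv r th) * hker t (yv r th + c).

Lemma jc_inner s : jointly_continuous (inner s).
Proof.
  intros U c r t th x Hc Hr Ht Hth Hd. unfold inner.
  assert (H1 := continuous_jac r th x Hr Hth).
  assert (H2 := continuous_yv r th x Hr Hth).
  assert (H3 := continuous_hker t (fun u => yv (r u) (th u) + c u) x Ht
     ltac:(cont) (yv_dom _ _ _ _ Hd)).
  cont.
Qed.

(** The second factor equals [sqrt (r^2 - yv^2)] wherever [cos th >= 0]; writing the derivative in
    this shape makes the cancellation in [inner_g] immediate. *)
Definition dyv (r th : R) : R :=
  jac r th * (r * sqrt (r ^ 2 + 4) * cos th / sqrt (qv r th)).

Lemma is_derive_yv r x : is_derive (yv r) x (dyv r x).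
Proof.
  assert (Hq := qv_ge r x). assert (Hs := sqrt_qv_pos r x).
  assert (Hq2 := pow2_sqrt (qv r x) ltac:(lra)).
  assert (Hr : 0 < r ^ 2 + 4) by (generalize (pow2_ge_0 r); lra).
  assert (Hr2 := pow2_sqrt (r ^ 2 + 4) ltac:(lra)).
  unfold yv, dyv, jac, qv in *. auto_derive;
  change (r * (r * 1) + 4 + - (r * (r * 1) * (sin x * (sin x * 1))))
      with (r ^ 2 + 4 - r ^ 2 * sin x ^ 2).
  - repeat split; lra.
  -    replace (2 * sqrt (r ^ 2 + 4) / (r ^ 2 + 4 - r ^ 2 * sin x ^ 2)
      * (r * sqrt (r ^ 2 + 4) * cos x / sqrt (r ^ 2 + 4 - r ^ 2 * sin x ^ 2)))
    with (2 * r * sqrt (r ^ 2 + 4) ^ 2 * cos x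
      / (sqrt (r ^ 2 + 4 - r ^ 2 * sin x ^ 2) ^ 2
         * sqrt (r ^ 2 + 4 - r ^ 2 * sin x ^ 2)))
    by (rewrite Hq2; field; lra).
    rewrite Hr2.
    set (w := sqrt (r ^ 2 + 4 - r ^ 2 * sin x ^ 2)) in *.
    (* Eliminating [r ^ 2 + 4] in favour of [w] leaves a rational identity for [field]. *)
    replace (r ^ 2 + 4) with (w ^ 2 + r ^ 2 * sin x ^ 2) by lra.
    field. lra.
Qed.

Lemma sqrt_r_yv r x : 0 < r -> 0 <= cos x ->
  sqrt (r + yv r x) * sqrt (r - yv r x)
  = r * sqrt (r ^ 2 + 4) * cos x / sqrt (qv r x).
Proof.
  intros Hr Hk. destruct (yv_bound r x Hr).
  assert (Hq := qv_ge r x).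
  rewrite <- sqrt_mult_alt by lra.
  replace ((r + yv r x) * (r - yv r x)) with (r ^ 2 - yv r x ^ 2) by ring.
  rewrite sqr_sub_yv, sqrt_div_alt by lra.
  replace (r ^ 2 * (r ^ 2 + 4) * cos x ^ 2)
    with ((r * cos x) ^ 2 * (r ^ 2 + 4)) by ring.
  rewrite sqrt_sqr_mult by nra. f_equal. ring.
Qed.

Lemma yv_PI2 r : 0 < r -> yv r (PI / 2) = r.
Proof.
  intros Hr. unfold yv, qv. rewrite sin_PI2.
  replace (r ^ 2 + 4 - r ^ 2 * 1 ^ 2) with (2 ^ 2) by ring.
  rewrite sqrt_pow2 by lra. field.
Qed.

Lemma yv_opp r th : yv r (- th) = - yv r th.
Proof.
  unfold yv, qv. rewrite sin_neg.
  replace ((- sin th) ^ 2) with (sin th ^ 2) by ring.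
  field. apply Rgt_not_eq. apply sqrt_qv_pos.
Qed.

Lemma jac_opp r th : jac r (- th) = jac r th.
Proof.
  unfold jac, qv. rewrite sin_neg.
  now replace ((- sin th) ^ 2) with (sin th ^ 2) by ring.
Qed.

Lemma hker_opp t z : hker t (- z) = hker t z.
Proof. unfold hker, radh. now replace ((- z) ^ 2) with (z ^ 2) by ring. Qed.

Lemma sqr_lt_of_cos_pos r x : 0 < r -> 0 < cos x -> - r < yv r x < r.
Proof.
  intros Hr Hk.
  assert (0 < r ^ 2 - yv r x ^ 2); [|nra].
  rewrite sqr_sub_yv. generalize (qv_ge r x). intros.
  apply Rdiv_lt_0_compat; [|lra]. repeat apply Rmult_lt_0_compat; nra.
Qed.

Lemma sqrt_radh t z : - t < z < t ->
  sqrt (radh t z) = sqrt (t ^ 2 - z ^ 2) * sqrt (z ^ 2 + 4).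
Proof. intros. unfold radh. apply sqrt_mult_alt. nra. Qed.

Lemma inner_g (s : R) (g : R -> R) c r t : dom c r t ->
  (forall z, c - r < z < c + r -> continuous g z) ->
  (forall y, - r < y < r -> g (c + y)
     = (r + s * y) / (sqrt (r + y) * sqrt (r - y)) * hker t (y + c)) ->
  improper_integral g (- (r - c)) (r + c)
    (RInt (inner s c r t) (- (PI / 2)) (PI / 2)).
Proof.
  intros H Hg Hgy. assert (H' := H). unfold dom in H'.
  assert (Hpi := PI_RGT_0).
  assert (E1 : c + yv r (- (PI / 2)) = - (r - c)).
  { rewrite yv_opp, yv_PI2 by lra. ring. }
  assert (E2 : c + yv r (PI / 2) = r + c).
  { rewrite yv_PI2 by lra. ring. }
  rewrite <- E1, <- E2.
  apply improper_integral_subst with (phi := fun x => c + yv r x) (dphi := dyv r).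
  - lra.
  - intros x. replace (dyv r x) with (0 + dyv r x) by ring.
    apply (is_derive_plus (K := R_AbsRing) (V := R_NormedModule)).
    + apply (is_derive_const (K := R_AbsRing) (V := R_NormedModule)).
    + apply is_derive_yv.
  - intros x. unfold dyv, qv.
    assert (Hj := continuous_jac (fun _ => r) (fun x => x) x
      (continuous_const _ _) (continuous_id _)). cont.
    generalize (sqrt_qv_pos r x). unfold qv. lra.
  - intros x Hx. assert (Hk : 0 < cos x) by (apply cos_gt_0; lra).
    unfold dyv. apply Rmult_lt_0_compat; [apply jac_pos|].
    apply Rdiv_lt_0_compat; [|apply sqrt_qv_pos].
    apply Rmult_lt_0_compat; [|lra]. apply Rmult_lt_0_compat; [lra|].
    apply sqrt_lt_R0. generalize (pow2_ge_0 r); lra.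
  - intros z Hz. rewrite E1, E2 in Hz. apply Hg; lra.
  - intros x. now apply (jc_const_th _ c r t (jc_inner s)).
  - intros x Hx. assert (Hk : 0 < cos x) by (apply cos_gt_0; lra).
    assert (Hy := sqr_lt_of_cos_pos r x ltac:(lra) Hk).
    rewrite Hgy by lra. unfold dyv, inner.
    rewrite <- sqrt_r_yv by lra. field.
    split; apply sqrt_neq_0; lra.
Qed.

Lemma inner_g1 c r t : dom c r t ->
  improper_integral (g1 (r - c) (r + c) t) (- (r - c)) (r + c)
    (RInt (inner 1 c r t) (- (PI / 2)) (PI / 2)).
Proof.
  intros H. assert (H' := H). unfold dom in H'.
  apply inner_g; [exact H| |].
  - intros z Hz. apply continuous_g1; lra.
  - intros y Hy. unfold g1, hker. rewrite sqrt_radh by lra.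
    replace (c + y + (r - c)) with (r + y) by ring.
    replace (c + y - (r + c)) with (- (r - y)) by ring.
    rewrite Rabs_Ropp, !Rabs_pos_eq by lra.
    replace (c + y) with (y + c) by ring.
    replace (r + 1 * y) with (sqrt (r + y) ^ 2) by (rewrite pow2_sqrt; lra).
    assert (0 < t ^ 2 - (y + c) ^ 2).
    { assert (Hz : - t < y + c < t) by lra. revert Hz.
      generalize (y + c). intros; nra. }
    assert (0 < (y + c) ^ 2 + 4) by (generalize (pow2_ge_0 (y + c)); lra).
    field. repeat split; apply sqrt_neq_0; lra.
Qed.

Lemma inner_g2 c r t : dom c r t ->
  improper_integral (g2 (r - c) (r + c) t) (- (r - c)) (r + c)
    (RInt (inner (-1) c r t) (- (PI / 2)) (PI / 2)).
Proof.
  intros H. assert (H' := H). unfold dom in H'.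
  apply inner_g; [exact H| |].
  - intros z Hz. apply continuous_g2; lra.
  - intros y Hy. unfold g2, hker. rewrite sqrt_radh by lra.
    replace (c + y + (r - c)) with (r + y) by ring.
    replace (c + y - (r + c)) with (- (r - y)) by ring.
    rewrite Rabs_Ropp, !Rabs_pos_eq by lra.
    replace (c + y) with (y + c) by ring.
    replace (r + -1 * y) with (sqrt (r - y) ^ 2) by (rewrite pow2_sqrt; lra).
    assert (0 < t ^ 2 - (y + c) ^ 2).
    { assert (Hz : - t < y + c < t) by lra. revert Hz.
      generalize (y + c). intros; nra. }
    assert (0 < (y + c) ^ 2 + 4) by (generalize (pow2_ge_0 (y + c)); lra).
    field. repeat split; apply sqrt_neq_0; lra.
Qed.

(** * Separation of the even and odd parts in [c] *)

Lemma RInt_symm (f : R -> R) (b : R) : (forall x, continuous f x) ->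
  RInt f (- b) b = RInt (fun x => f x + f (- x)) 0 b.
Proof.
  intros Hf.
  assert (Hf' : forall x, continuous (fun x => f (- x)) x).
  { intros x. apply (continuous_comp (fun x => - x) f); [cont|apply Hf]. }
  rewrite <- (RInt_Chasles f (- b) 0 b) by (now apply ex_RInt_cont).
  rewrite (RInt_plus f (fun x => f (- x))) by (now apply ex_RInt_cont).
  rewrite plus_comm. f_equal.
  rewrite <- Ropp_0 at 1. symmetry. apply is_RInt_unique.
  apply is_RInt_reflect. now apply ex_RInt_cont.
Qed.

Lemma RInt_lin (f g h : R -> R) (u v a b : R) :
  (forall x, continuous f x) -> (forall x, continuous g x) ->
  (forall x, h x = u * f x + v * g x) ->
  RInt h a b = u * RInt f a b + v * RInt g a b.
Proof.
  intros Hf Hg Hh.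
  rewrite (RInt_ext h (fun x => plus (scal u (f x)) (scal v (g x))))
    by (intros; apply Hh).
  rewrite (RInt_plus (fun x => scal u (f x)) (fun x => scal v (g x))).
  - rewrite (RInt_scal f), (RInt_scal g) by now apply ex_RInt_cont. reflexivity.
  - apply (ex_RInt_scal (V := R_NormedModule)). now apply ex_RInt_cont.
  - apply (ex_RInt_scal (V := R_NormedModule)). now apply ex_RInt_cont.
Qed.

Lemma RInt_const_mult (f h : R -> R) (u a b : R) :
  (forall x, continuous f x) -> (forall x, h x = u * f x) ->
  RInt h a b = u * RInt f a b.
Proof.
  intros Hf Hh.
  rewrite (RInt_lin f f h u 0 a b Hf Hf).
  { rewrite Rmult_0_l. apply Rplus_0_r. }
  intros x. rewrite Hh. ring.
Qed.

(** Folding the range at 0 sends [y] to [- y], and [hker] is even. Hence [r] multiplies the sum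
    [hker (y + c) + hker (y - c)], while [s y] multiplies the difference, from which [hquotE]
    extracts a factor [c]. *)
Lemma RInt_inner s c r t : dom c r t ->
  RInt (inner s c r t) (- (PI / 2)) (PI / 2)
  = r * intA0 c r t + s * c * intA1 c r t.
Proof.
  intros H.
  rewrite RInt_symm by exact (jc_const_th _ c r t (jc_inner s) H).
  unfold intA0, intA1. apply RInt_lin.
  - exact (jc_const_th _ c r t jc_kerA0 H).
  - exact (jc_const_th _ c r t jc_kerA1 H).
  - intros x. unfold inner, kerA0, kerA1. rewrite yv_opp, jac_opp.
    replace (- yv r x + c) with (- (yv r x - c)) by ring. rewrite hker_opp.
    replace (s * c * (jac r x * (yv r x * hquot c t (yv r x))))
      with (s * jac r x * yv r x * (c * hquot c t (yv r x))) by ring.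
    rewrite <- hquotE by auto using yv_dom, yv_dom'. ring.
Qed.

(** The two intervals carry opposite [s] and [c], so the terms in [s r] combine to
    [W c - W (- c) = c * Wquot c]; all other terms form [kerB1]. *)
Lemma RInt_outer s c r t : dom c r t ->
  RInt (outer s c r t) 0 (PI / 2) + RInt (outer (- s) (- c) r t) 0 (PI / 2)
  = intB1 c r t + s * r * c * intB0 c r t.
Proof.
  intros H. unfold intB1, intB0.
  rewrite <- (RInt_plus (outer s c r t)).
  - rewrite <- (Rmult_1_l (RInt (kerB1 c r t) _ _)). apply RInt_lin.
    + exact (jc_const_th _ c r t jc_kerB1 H).
    + exact (jc_const_th _ c r t jc_Wquot H).
    + intros x. unfold outer, kerB1, plus; simpl AbelianMonoid.plus.
      replace (s * r * c * Wquot c r t x) with (s * r * (c * Wquot c r t x)) by ring.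
      rewrite <- WquotE by auto. simpl. ring.
  - apply ex_RInt_cont. exact (jc_const_th _ c r t (jc_outer s) H).
  - apply ex_RInt_cont.
    exact (jc_const_th _ (- c) r t (jc_outer (- s)) (dom_opp _ _ _ H)).
Qed.

Lemma inner_pos s c r t : dom c r t -> -1 <= s <= 1 ->
  0 < RInt (inner s c r t) (- (PI / 2)) (PI / 2).
Proof.
  intros H Hs. assert (H' := H). unfold dom in H'. generalize PI_RGT_0; intros Hpi.
  apply RInt_gt_0; [lra| |].
  - intros x Hx. assert (Hk : 0 < cos x) by (apply cos_gt_0; lra).
    assert (Hy := sqr_lt_of_cos_pos r x ltac:(lra) Hk).
    unfold inner. apply Rmult_lt_0_compat; [apply Rmult_lt_0_compat|].
    + apply jac_pos.
    + destruct (Rle_lt_dec 0 (yv r x)); nra.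
    + apply Rinv_0_lt_compat, sqrt_lt_R0, radh_pos. now apply yv_dom.
  - intros x _. exact (jc_const_th _ c r t (jc_inner s) H x).
Qed.

(** [Qfun] is [(B1 + r c B0) / (r A0 + c A1) - (B1 - r c B0) / (r A0 - c A1)]. In the cross product
    only the terms odd in [c] survive, namely [2 c M], and both denominators are integrals of
    positive functions. *)
Lemma Qfun_zero_iff c r t : dom c r t -> c <> 0 ->
  (Qfun (r - c) (r + c) t = 0 <-> M c r t = 0).
Proof.
  intros H Hc. assert (H' := H). unfold dom in H'.
  assert (O1 : - t < - (r - c)) by lra. assert (O2 : - (r - c) < r + c) by lra.
  assert (O3 : r + c < t) by lra.
  unfold Qfun.
  rewrite (impint_eq _ _ _ _ O1 (outer_left_g1 c r t H)).
  rewrite (impint_eq _ _ _ _ O2 (inner_g1 c r t H)).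
  rewrite (impint_eq _ _ _ _ O3 (outer_g1 c r t H)).
  rewrite (impint_eq _ _ _ _ O1 (outer_left_g2 c r t H)).
  rewrite (impint_eq _ _ _ _ O2 (inner_g2 c r t H)).
  rewrite (impint_eq _ _ _ _ O3 (outer_g2 c r t H)).
  assert (I2 := inner_pos 1 c r t H ltac:(lra)).
  assert (J2 := inner_pos (-1) c r t H ltac:(lra)).
  assert (E1 := RInt_outer 1 c r t H). assert (E2 := RInt_outer (-1) c r t H).
  replace (Ropp 1) with (-1) in E1 by lra. replace (Ropp (-1)) with 1 in E2 by lra.
  rewrite (Rplus_comm (RInt (outer (-1) (- c) _ _) _ _)), E1. rewrite (Rplus_comm (RInt (outer 1 _ _ _) _ _)), E2.
  rewrite !RInt_inner in * by auto.
  replace ((intB1 c r t + 1 * r * c * intB0 c r t) / (r * intA0 c r t + 1 * c * intA1 c r t) -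
    (intB1 c r t + -1 * r * c * intB0 c r t) / (r * intA0 c r t + -1 * c * intA1 c r t))
  with (2 * c * M c r t / ((r * intA0 c r t + 1 * c * intA1 c r t)
        * (r * intA0 c r t + -1 * c * intA1 c r t))) by (unfold M; field; lra).
  split; intros HM.
  - apply Rmult_integral in HM. destruct HM as [HM|HM].
    + apply Rmult_integral in HM. destruct HM; [lra|easy].
    + apply Rinv_neq_0_compat in HM; [easy|]. apply Rgt_not_eq.
      now apply Rmult_lt_0_compat.
  - rewrite HM. unfold Rdiv. ring.
Qed.

(** * Complete elliptic integrals and the value on the diagonal *)

Lemma one_sub_mul_pos (m s : R) : m < 1 -> 0 <= s <= 1 -> 0 < 1 - m * s.
Proof. intros Hm Hs. destruct (Rle_lt_dec m 0); nra. Qed.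

Lemma Delta_pos (m x : R) : m < 1 -> 0 < 1 - m * sin x ^ 2.
Proof. intros H. apply one_sub_mul_pos; [exact H|apply sin2_bound]. Qed.

Lemma sqrt_Delta_pos (m x : R) : m < 1 -> 0 < sqrt (1 - m * sin x ^ 2).
Proof. intros H. now apply sqrt_lt_R0, Delta_pos. Qed.

Lemma continuous_invDelta (m x : R) : m < 1 ->
  continuous (fun x => / sqrt (1 - m * sin x ^ 2)) x.
Proof. intros H. cont. generalize (sqrt_Delta_pos m x H). lra. Qed.

Lemma continuous_Delta (m x : R) : continuous (fun x => sqrt (1 - m * sin x ^ 2)) x.
Proof. cont. Qed.

Lemma continuous_s_invDelta (m x : R) : m < 1 ->
  continuous (fun x => sin x ^ 2 / sqrt (1 - m * sin x ^ 2)) x.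
Proof. intros H. cont. generalize (sqrt_Delta_pos m x H). lra. Qed.

Lemma continuous_s_invDelta3 (m x : R) : m < 1 ->
  continuous (fun x => sin x ^ 2 / sqrt (1 - m * sin x ^ 2) ^ 3) x.
Proof.
  intros H. cont. apply pow_nonzero. generalize (sqrt_Delta_pos m x H). lra.
Qed.

Lemma PI2_pos : 0 < PI / 2.
Proof. generalize PI_RGT_0; lra. Qed.

Lemma ellK_RInt (m : R) : m < 1 ->
  ellK m = RInt (fun x => / sqrt (1 - m * sin x ^ 2)) 0 (PI / 2).
Proof.
  intros H. apply impint_proper; [apply PI2_pos|].
  intros x. now apply continuous_invDelta.
Qed.

Lemma ellE_RInt (m : R) :
  ellE m = RInt (fun x => sqrt (1 - m * sin x ^ 2)) 0 (PI / 2).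
Proof. apply impint_proper; [apply PI2_pos|]. apply continuous_Delta. Qed.

(** Legendre's third standard integral [D = (K - E) / m], written in a form regular at [m = 0]. *)
Definition ellD (m : R) : R :=
  RInt (fun x => sin x ^ 2 / sqrt (1 - m * sin x ^ 2)) 0 (PI / 2).

Lemma ellD_eq (m : R) : m < 1 -> m * ellD m = ellK m - ellE m.
Proof.
  intros H. rewrite ellK_RInt, ellE_RInt by exact H. unfold ellD.
  rewrite <- (RInt_const_mult (fun x => sin x ^ 2 / sqrt (1 - m * sin x ^ 2))
    (fun x => m * (sin x ^ 2 / sqrt (1 - m * sin x ^ 2))) m
    0 (PI / 2) (fun x => continuous_s_invDelta m x H)) by reflexivity.
  rewrite (RInt_lin (fun x => / sqrt (1 - m * sin x ^ 2))
    (fun x => sqrt (1 - m * sin x ^ 2)) _ 1 (-1)).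
  - ring.
  - intros; now apply continuous_invDelta.
  - apply continuous_Delta.
  - intros x. assert (Hs := sqrt_Delta_pos m x H).
    assert (Hq := pow2_sqrt _ (Rlt_le _ _ (Delta_pos m x H))).
    apply (Rmult_eq_reg_r (sqrt (1 - m * sin x ^ 2))); [|lra].
    field_simplify; [|lra|lra]. rewrite Hq. ring.
Qed.

(** The integral is twice the derivative of [ellK]. It is evaluated by adding the exact derivative
    of [sin * cos / Delta], a function vanishing at both ends of the range. *)
Lemma second_kind (m : R) : m < 1 ->
  m * (1 - m) * RInt (fun x => sin x ^ 2 / sqrt (1 - m * sin x ^ 2) ^ 3) 0 (PI / 2)
  = ellE m - (1 - m) * ellK m.
Proof.
  intros H.
  set (F := fun x => sin x * cos x / sqrt (1 - m * sin x ^ 2)).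
  set (dF := fun x => (1 - 2 * sin x ^ 2 + m * sin x ^ 4)
                      / sqrt (1 - m * sin x ^ 2) ^ 3).
  assert (HdF : forall x, continuous dF x).
  { intros x. unfold dF. cont. apply pow_nonzero.
    generalize (sqrt_Delta_pos m x H). lra. }
  assert (HI : RInt dF 0 (PI / 2) = 0).
  { apply is_RInt_unique.
    replace 0 with (minus (F (PI / 2)) (F 0)) at 2.
    - apply (is_RInt_derive F dF); intros x _; [|apply HdF].
      assert (Hd := Delta_pos m x H). assert (Hs := sqrt_Delta_pos m x H).
      assert (Hq := pow2_sqrt _ (Rlt_le _ _ Hd)).
      unfold F, dF. auto_derive;
      change (1 + - (m * (sin x * (sin x * 1)))) with (1 - m * sin x ^ 2).
      + repeat split; lra.
      + set (w := sqrt (1 - m * sin x ^ 2)) in *.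
        apply (Rmult_eq_reg_r (w ^ 3)); [|apply pow_nonzero; lra].
        transitivity (w ^ 2 * (cos x ^ 2 - sin x ^ 2) + m * sin x ^ 2 * cos x ^ 2).
        { field. lra. }
        rewrite Hq.
        replace (cos x ^ 2) with (1 - sin x ^ 2) by (rewrite sin2_eq; ring).
        field. lra.
    - unfold F, minus, plus, opp; simpl. rewrite cos_PI2, sin_0.
      unfold Rdiv. ring. }
  (* With [Delta = sqrt (1 - m sin^2)], pointwise [(1 - m) / Delta + m dF = Delta - m (1 - m) sin^2
     / Delta^3]; integrating both sides gives the claim. *)
  assert (E := RInt_lin (fun x => / sqrt (1 - m * sin x ^ 2)) dF
    (fun x => (1 - m) * / sqrt (1 - m * sin x ^ 2) + m * dF x)
    (1 - m) m 0 (PI / 2)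
    (fun x => continuous_invDelta m x H) HdF (fun x => eq_refl)).
  rewrite (RInt_lin (fun x => sqrt (1 - m * sin x ^ 2))
    (fun x => sin x ^ 2 / sqrt (1 - m * sin x ^ 2) ^ 3) _ 1 (- (m * (1 - m)))) in E.
  - rewrite HI, <- ellK_RInt, <- ellE_RInt in E by exact H. lra.
  - apply continuous_Delta.
  - intros. now apply continuous_s_invDelta3.
  - intros x. assert (Hd := Delta_pos m x H). assert (Hs := sqrt_Delta_pos m x H).
    assert (Hq := pow2_sqrt _ (Rlt_le _ _ Hd)).
    unfold dF. set (w := sqrt (1 - m * sin x ^ 2)) in *.
    apply (Rmult_eq_reg_r (w ^ 3)); [|apply pow_nonzero; lra].
    transitivity ((1 - m) * w ^ 2 + m * (1 - 2 * sin x ^ 2 + m * sin x ^ 4)).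
    { field. lra. }
    transitivity ((w ^ 2) ^ 2 - m * (1 - m) * sin x ^ 2).
    { rewrite Hq. ring. }
    field. lra.
Qed.

Lemma ellK_pos (m : R) : m < 1 -> 0 < ellK m.
Proof.
  intros H. rewrite ellK_RInt by exact H.
  apply RInt_gt_0; [apply PI2_pos| |]; intros x _.
  - now apply Rinv_0_lt_compat, sqrt_Delta_pos.
  - now apply continuous_invDelta.
Qed.

Lemma ellD_bounds (m : R) : m < 1 -> 0 < ellD m < ellK m.
Proof.
  intros H. split.
  - apply RInt_gt_0; [apply PI2_pos| |].
    + intros x Hx. destruct (sin_cos_pos x Hx).
      apply Rdiv_lt_0_compat; [nra|now apply sqrt_Delta_pos].
    + intros. now apply continuous_s_invDelta.
  - rewrite ellK_RInt by exact H. unfold ellD.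
    apply RInt_lt; [apply PI2_pos| | |].
    + intros. now apply continuous_invDelta.
    + intros. now apply continuous_s_invDelta.
    + intros x Hx. destruct (sin_cos_pos x Hx).
      assert (Hs := sqrt_Delta_pos m x H). unfold Rdiv.
      rewrite <- (Rmult_1_l (/ _)) at 2. apply Rmult_lt_compat_r.
      * now apply Rinv_0_lt_compat.
      * rewrite sin2_eq. nra.
Qed.

Lemma asin_sqr (mu : R) : 0 < mu < 1 ->
  exists x, 0 < x < PI / 2 /\ sin x ^ 2 = mu.
Proof.
  intros H. assert (Hs := sqrt_lt_R0 mu ltac:(lra)).
  assert (Hq := pow2_sqrt mu ltac:(lra)).
  assert (sqrt mu < 1) by nra.
  exists (asin (sqrt mu)).
  assert (Hb := asin_bound_lt (sqrt mu) ltac:(lra)).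
  assert (Hsin := sin_asin (sqrt mu) ltac:(lra)).
  rewrite Hsin. repeat split; [|lra|exact Hq].
  apply Rnot_le_lt. intros Hle.
  assert (0 <= sin (- asin (sqrt mu))) by (apply sin_ge_0; lra).
  rewrite sin_neg in *. lra.
Qed.

(** After squaring and clearing denominators the difference of the two sides is
    [(m' - m) (s - mu)]. *)
Lemma weight_comparison (m m' mu s : R) :
  m < m' -> m < 1 -> m' < 1 -> 0 <= mu <= 1 -> 0 <= s <= 1 -> mu < s ->
  sqrt (1 - m * mu) / sqrt (1 - m * s) < sqrt (1 - m' * mu) / sqrt (1 - m' * s).
Proof.
  intros Hm H1 H2 Hmu Hs Hlt.
  assert (K1 : 0 < 1 - m * mu) by now apply one_sub_mul_pos.
  assert (K2 : 0 < 1 - m * s) by now apply one_sub_mul_pos.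
  assert (K3 : 0 < 1 - m' * mu) by now apply one_sub_mul_pos.
  assert (K4 : 0 < 1 - m' * s) by now apply one_sub_mul_pos.
  rewrite <- !sqrt_div_alt by assumption.
  apply sqrt_lt_1_alt. split; [left; now apply Rdiv_lt_0_compat|].
  apply Rlt_div_l; [assumption|].
  replace ((1 - m' * mu) / (1 - m' * s) * (1 - m * s))
    with ((1 - m' * mu) * (1 - m * s) / (1 - m' * s)) by (field; lra).
  apply Rlt_div_r; [assumption|]. nra.
Qed.

(* [ellD / ellK] is the mean of [sin^2] for the weight [1 / Delta], whose mass
   moves towards larger [sin^2] as [m] grows. *)
Lemma ellD_ellK_increasing (m m' : R) : m < m' -> m' < 1 ->
  ellD m * ellK m' < ellD m' * ellK m.
Proof.
  intros Hm Hm'. assert (H : m < 1) by lra.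
  assert (HK := ellK_pos m H). assert (HK' := ellK_pos m' Hm').
  assert (HD := ellD_bounds m H).
  set (mu := ellD m / ellK m).
  assert (Hmu : 0 < mu < 1).
  { unfold mu. split; [apply Rdiv_lt_0_compat; lra|]. apply Rlt_div_l; lra. }
  destruct (asin_sqr mu Hmu) as [x0 [Hx0 Hmx]].
  set (l := sqrt (1 - m * mu)). set (l' := sqrt (1 - m' * mu)).
  (* Scaling by [l] and [l'] makes both weights equal to 1 where [sin^2 = mu]. Both factors of [F]
     then change sign exactly at [x0], so [F] is positive on either side of it. *)
  set (F := fun x => (sin x ^ 2 - mu)
    * (l' / sqrt (1 - m' * sin x ^ 2) - l / sqrt (1 - m * sin x ^ 2))).
  assert (HF : forall x, continuous F x).
  { intros x. unfold F. cont; [generalize (sqrt_Delta_pos m' x Hm')|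
      generalize (sqrt_Delta_pos m x H)]; lra. }
  assert (Hpi := PI2_pos).
  assert (P1 : 0 < RInt F 0 x0).
  { apply RInt_gt_0; [lra| |intros; apply HF].
    intros x Hx.
    assert (sin x < sin x0) by (apply sin_increasing_1; lra).
    assert (0 < sin x) by (apply sin_cos_pos; lra).
    assert (Hs : sin x ^ 2 < mu) by nra.
    assert (Hw := weight_comparison m m' (sin x ^ 2) mu Hm H Hm'
      (sin2_bound x) ltac:(lra) Hs).
    fold l l' in Hw. unfold F.
    assert (S1 := sqrt_Delta_pos m x H). assert (S2 := sqrt_Delta_pos m' x Hm').
    assert (L1 : 0 < l) by (apply sqrt_lt_R0, one_sub_mul_pos; lra).
    assert (L2 : 0 < l') by (apply sqrt_lt_R0, one_sub_mul_pos; lra).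
    set (w := sqrt (1 - m * sin x ^ 2)) in *.
    set (w' := sqrt (1 - m' * sin x ^ 2)) in *.
    (* Here [mu] is the larger argument, so the comparison gives the inequality for the
       reciprocals. *)
    assert (l' / w' < l / w); [|nra].
    apply Rmult_lt_reg_r with (w / l * (w' / l')).
    { apply Rmult_lt_0_compat; now apply Rdiv_lt_0_compat. }
    replace (l' / w' * (w / l * (w' / l'))) with (w / l) by (field; lra).
    replace (l / w * (w / l * (w' / l'))) with (w' / l') by (field; lra).
    exact Hw. }
  assert (P2 : 0 < RInt F x0 (PI / 2)).
  { apply RInt_gt_0; [lra| |intros; apply HF].
    intros x Hx.
    assert (sin x0 < sin x) by (apply sin_increasing_1; lra).
    assert (0 < sin x0) by (apply sin_cos_pos; lra).
    assert (Hs : mu < sin x ^ 2) by nra.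
    assert (Hw := weight_comparison m m' mu (sin x ^ 2) Hm H Hm'
      ltac:(lra) (sin2_bound x) Hs).
    fold l l' in Hw. unfold F. apply Rmult_lt_0_compat; lra. }
  assert (E : RInt F 0 (PI / 2)
     = l' * (ellD m' - mu * ellK m') + - l * (ellD m - mu * ellK m) :> R).
  { rewrite !ellK_RInt by assumption. unfold ellD.
    assert (Hc : forall k, k < 1 -> forall x, continuous (fun x =>
        1 * (sin x ^ 2 / sqrt (1 - k * sin x ^ 2))
        + - mu * / sqrt (1 - k * sin x ^ 2)) x).
    { intros k Hk x. generalize (sqrt_Delta_pos k x Hk). intros. cont; lra. }
    assert (Hl : forall k, k < 1 -> RInt (fun x =>
        1 * (sin x ^ 2 / sqrt (1 - k * sin x ^ 2))
        + - mu * / sqrt (1 - k * sin x ^ 2)) 0 (PI / 2)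
      = 1 * RInt (fun x => sin x ^ 2 / sqrt (1 - k * sin x ^ 2)) 0 (PI / 2)
        + - mu * RInt (fun x => / sqrt (1 - k * sin x ^ 2)) 0 (PI / 2)).
    { intros k Hk. apply RInt_lin; intros.
      - now apply continuous_s_invDelta.
      - now apply continuous_invDelta.
      - reflexivity. }
    rewrite (RInt_lin _ _ F l' (- l) 0 (PI / 2) (Hc m' Hm') (Hc m H)).
    - rewrite !Hl by assumption. ring.
    - intros x. unfold F, Rdiv. ring. }
  rewrite <- (RInt_Chasles F 0 x0) in E by now apply ex_RInt_cont.
  unfold plus in E; simpl in E.
  (* As [mu] is the mean of [sin^2] for the modulus [m], the second term of [E] drops out and
     positivity passes to the first. *)
  assert (Hz : ellD m - mu * ellK m = 0) by (unfold mu; field; lra).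
  rewrite Hz in E.
  assert (0 < l') by (apply sqrt_lt_R0, one_sub_mul_pos; lra).
  assert (0 < ellD m' - mu * ellK m') by nra.
  replace (ellD m) with (mu * ellK m) by lra. nra.
Qed.

(** * The two moduli and the sign of the defining equation *)

Definition modulus1 (r t : R) : R := (r ^ 2 + 4) / (t ^ 2 + 4).
Definition modulus2 (r t : R) : R := r ^ 2 / t ^ 2 * ((t ^ 2 + 4) / (r ^ 2 + 4)).

Lemma modulus1_bounds r t : 0 < r < t -> 0 < modulus1 r t < 1.
Proof.
  intros H. unfold modulus1. split.
  - apply Rdiv_lt_0_compat; nra.
  - apply Rlt_div_l; nra.
Qed.

Lemma modulus2_bounds r t : 0 < r < t -> 0 < modulus2 r t < 1.
Proof.
  intros H. unfold modulus2.
  replace (r ^ 2 / t ^ 2 * ((t ^ 2 + 4) / (r ^ 2 + 4)))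
    with (r ^ 2 * (t ^ 2 + 4) / (t ^ 2 * (r ^ 2 + 4))) by (field; nra).
  assert (0 < r ^ 2) by nra. assert (r ^ 2 < t ^ 2) by nra.
  split.
  - apply Rdiv_lt_0_compat; nra.
  - apply Rlt_div_l; nra.
Qed.

Definition Gfun (m1 m2 : R) : R :=
  ellKbar m1 * ellE m2 + m2 * ellEbar m1 * ellK m2 - ellKbar m1 * ellK m2.

(** Substituting [ellE m2 = ellK m2 - m2 * ellD m2] cancels the product of the two [K] values and
    separates the variables: the zeros are given by [ellEbar m1 / ellKbar m1 = ellD m2 / ellK
    m2]. *)
Lemma Gfun_eq m1 m2 : m2 < 1 ->
  Gfun m1 m2 = m2 * (ellEbar m1 * ellK m2 - ellKbar m1 * ellD m2).
Proof.
  intros H. unfold Gfun. generalize (ellD_eq m2 H). intros E.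
  replace (ellE m2) with (ellK m2 - m2 * ellD m2) by lra. ring.
Qed.

Lemma Gfun_sign_right m1 m2 m2' : 0 < m1 -> 0 < m2 < m2' -> m2' < 1 ->
  Gfun m1 m2 = 0 -> Gfun m1 m2' < 0.
Proof.
  intros H1 H2 H2' HG. rewrite Gfun_eq in * by lra.
  assert (HK := ellK_pos (1 - m1) ltac:(lra)). fold (ellKbar m1) in HK.
  assert (Hm := ellD_ellK_increasing m2 m2' ltac:(lra) ltac:(lra)).
  assert (K2 := ellK_pos m2 ltac:(lra)).
  assert (E : ellEbar m1 * ellK m2 = ellKbar m1 * ellD m2) by nra.
  (* The factor [ellK m2 > 0] lets the equation at [m2] be substituted without division; what
     remains is the monotonicity of [ellD / ellK]. *)
  assert (ellK m2 * (ellEbar m1 * ellK m2' - ellKbar m1 * ellD m2') < 0); [|nra].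
  replace (ellK m2 * (ellEbar m1 * ellK m2' - ellKbar m1 * ellD m2'))
    with (ellEbar m1 * ellK m2 * ellK m2' - ellKbar m1 * (ellD m2' * ellK m2)) by ring.
  rewrite E. nra.
Qed.

Lemma Gfun_sign_left m1 m2 m2' : 0 < m1 -> 0 < m2' < m2 -> m2 < 1 ->
  Gfun m1 m2 = 0 -> 0 < Gfun m1 m2'.
Proof.
  intros H1 H2 H2' HG. rewrite Gfun_eq in * by lra.
  assert (HK := ellK_pos (1 - m1) ltac:(lra)). fold (ellKbar m1) in HK.
  assert (Hm := ellD_ellK_increasing m2' m2 ltac:(lra) ltac:(lra)).
  assert (K2 := ellK_pos m2 ltac:(lra)).
  assert (E : ellEbar m1 * ellK m2 = ellKbar m1 * ellD m2) by nra.
  assert (0 < ellK m2 * (ellEbar m1 * ellK m2' - ellKbar m1 * ellD m2')).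
  { replace (ellK m2 * (ellEbar m1 * ellK m2' - ellKbar m1 * ellD m2'))
    with (ellEbar m1 * ellK m2 * ellK m2' - ellKbar m1 * (ellD m2' * ellK m2)) by ring.
    rewrite E. nra. }
  apply Rmult_lt_0_compat; [lra|]. nra.
Qed.

(** * The four integrals on the diagonal [c = 0] *)

Lemma RInt_flip (f : R -> R) : (forall x, continuous f x) ->
  RInt (fun x => f (PI / 2 - x)) 0 (PI / 2) = RInt f 0 (PI / 2).
Proof.
  intros Hf.
  assert (E := RInt_comp f (fun x => PI / 2 - x) (fun _ => -1) 0 (PI / 2)).
  rewrite Rminus_0_r, Rminus_diag in E.
  rewrite <- (opp_RInt_swap f) by now apply ex_RInt_cont.
  rewrite <- E.
  - rewrite <- RInt_opp.
    + apply RInt_ext. intros x _. unfold opp, scal; simpl. unfold mult; simpl. ring.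
    + apply ex_RInt_cont. intros x. unfold scal; simpl; unfold mult; simpl. cont.
      apply (continuous_comp (fun x => PI / 2 - x) f); [cont|apply Hf].
  - intros; apply Hf.
  - intros x _. split; [|apply continuous_const].
    auto_derive; [easy|ring].
Qed.

(** The origin of [modulus2]: under the substitution, [y^2 + 4 = 4 (r^2 + 4) / q] and [t^2 - y^2 =
    t^2 (r^2 + 4) (1 - m2 sin^2) / q], where [q = qv r x]. *)
Lemma sqrt_radh_yv r t x : 0 < r < t ->
  sqrt (radh t (yv r x))
  = 2 * t * (r ^ 2 + 4) / qv r x * sqrt (1 - modulus2 r t * sin x ^ 2).
Proof.
  intros H. assert (Hq := qv_ge r x).
  rewrite <- sqrt_sqr_mult.
  - f_equal. unfold radh. rewrite yv_sqr. unfold modulus2.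
    assert (Eq : sin x ^ 2 = (r ^ 2 + 4 - qv r x) / r ^ 2) by (unfold qv; field; lra).
    rewrite Eq. field. repeat split; nra.
  - apply Rdiv_le_0_compat; nra.
Qed.

Definition kappa (r t : R) : R := 2 * sqrt (r ^ 2 + 4) / (t * (r ^ 2 + 4)).

Lemma intA0_0 r t : 0 < r < t ->
  intA0 0 r t = kappa r t * ellK (modulus2 r t).
Proof.
  intros H. destruct (modulus2_bounds r t H) as [_ Hm].
  rewrite ellK_RInt by exact Hm. apply RInt_const_mult.
  - intros; now apply continuous_invDelta.
  - intros x. unfold kerA0, hker. rewrite Rplus_0_r, Rminus_0_r.
    rewrite sqrt_radh_yv by exact H. unfold jac, kappa.
    assert (Hs := sqrt_Delta_pos _ x Hm). assert (Hq := qv_ge r x).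
    field. repeat split; nra.
Qed.

Lemma intA1_0 r t : 0 < r < t ->
  intA1 0 r t = kappa r t * (t ^ 2 / (t ^ 2 - r ^ 2) * ellE (modulus2 r t)
                             - ellK (modulus2 r t)).
Proof.
  intros H. destruct (modulus2_bounds r t H) as [Hm0 Hm].
  unfold intA1.
  (* Write [t^2 - 4 - 2 y^2 = (t^2 - y^2) - (y^2 + 4)], which is [(r^2 + 4) / q] times
     [t^2 Delta^2 - 4]. The two summands produce the kernels [sin^2 / Delta] and [sin^2 / Delta^3]
     with these coefficients. *)
  rewrite (RInt_lin
    (fun x => sin x ^ 2 / sqrt (1 - modulus2 r t * sin x ^ 2) ^ 3)
    (fun x => sin x ^ 2 / sqrt (1 - modulus2 r t * sin x ^ 2)) _
    (kappa r t * r ^ 2 / (r ^ 2 + 4) * (4 / t ^ 2))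
    (- (kappa r t * r ^ 2 / (r ^ 2 + 4)))).
  - assert (S := second_kind _ Hm). assert (D := ellD_eq _ Hm). unfold ellD in D.
    set (I3 := RInt (fun x => sin x ^ 2 / sqrt _ ^ 3) 0 (PI / 2)) in *.
    set (I1 := RInt (fun x => sin x ^ 2 / sqrt _) 0 (PI / 2)) in *.
    replace I1 with ((ellK (modulus2 r t) - ellE (modulus2 r t)) / modulus2 r t)
      by (rewrite <- D; field; lra).
    replace I3 with ((ellE (modulus2 r t) - (1 - modulus2 r t) * ellK (modulus2 r t))
       / (modulus2 r t * (1 - modulus2 r t))) by (rewrite <- S; field; lra).
    generalize (ellK (modulus2 r t)) (ellE (modulus2 r t)) (kappa r t).
    intros K E k.
    replace (1 - modulus2 r t) with (4 * (t ^ 2 - r ^ 2) / (t ^ 2 * (r ^ 2 + 4)))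
      by (unfold modulus2; field; nra).
    unfold modulus2. field. repeat split; nra.
  - intros; now apply continuous_s_invDelta3.
  - intros; now apply continuous_s_invDelta.
  - intros x. unfold kerA1, hquot. rewrite Rplus_0_r, Rminus_0_r.
    rewrite sqrt_radh_yv by exact H.
    replace (jac r x * (yv r x * (- (4 * yv r x * (t ^ 2 - 4 - 2 * yv r x ^ 2 - 2 * 0 ^ 2)) /
       (2 * t * (r ^ 2 + 4) / qv r x * sqrt (1 - modulus2 r t * sin x ^ 2) *
        (2 * t * (r ^ 2 + 4) / qv r x * sqrt (1 - modulus2 r t * sin x ^ 2)) *
        (2 * t * (r ^ 2 + 4) / qv r x * sqrt (1 - modulus2 r t * sin x ^ 2) +
         2 * t * (r ^ 2 + 4) / qv r x * sqrt (1 - modulus2 r t * sin x ^ 2))))))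
    with (- (jac r x * (4 * yv r x ^ 2 * (t ^ 2 - 4 - 2 * yv r x ^ 2)))
      / (2 * (2 * t * (r ^ 2 + 4) / qv r x) ^ 3
         * sqrt (1 - modulus2 r t * sin x ^ 2) ^ 3)).
    + rewrite yv_sqr. unfold jac, kappa.
      assert (Hd := Delta_pos _ x Hm). assert (Hs := sqrt_Delta_pos _ x Hm).
      assert (Hw := pow2_sqrt _ (Rlt_le _ _ Hd)). assert (Hq := qv_ge r x).
      assert (Er : modulus2 r t * sin x ^ 2
        = (t ^ 2 + 4) * (r ^ 2 + 4 - qv r x) / (t ^ 2 * (r ^ 2 + 4)))
        by (unfold modulus2, qv; field; nra).
      assert (Es : sin x ^ 2 = (r ^ 2 + 4 - qv r x) / r ^ 2) by (unfold qv; field; lra).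
      rewrite Er in Hw.
      replace (sin x ^ 2 / sqrt (1 - modulus2 r t * sin x ^ 2))
        with (sin x ^ 2 * (sqrt (1 - modulus2 r t * sin x ^ 2)) ^ 2
              / sqrt (1 - modulus2 r t * sin x ^ 2) ^ 3) by (field; lra).
      rewrite Er in *. rewrite Hw.
      set (w := sqrt (1 - _)) in *. rewrite Es.
      field. repeat split; nra.
    + assert (Hs := sqrt_Delta_pos _ x Hm). assert (Hq := qv_ge r x).
      assert (0 < 2 * t * (r ^ 2 + 4) * sqrt (1 - modulus2 r t * sin x ^ 2))
        by (apply Rmult_lt_0_compat; nra).
      field. repeat split; nra.
Qed.

(** The complementary modulus enters here: [zeta^2 + 4 = t^2 + 4 - (t^2 - r^2) cos^2], and
    [1 - m1 = (t^2 - r^2) / (t^2 + 4)]. The cosine is the reason for [RInt_flip]. *)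
Lemma sqrt_P5_0 r t x : 0 < r < t ->
  sqrt (P5 0 r t x) = sqrt (t ^ 2 + 4) * sqrt (1 - (1 - modulus1 r t) * cos x ^ 2).
Proof.
  intros H. rewrite <- sqrt_mult_alt by nra. f_equal.
  unfold P5. rewrite Rmult_0_l, Rplus_0_r, zeta_sqr, sin2_eq.
  unfold modulus1. field. nra.
Qed.

Lemma radW_0 r t x : 0 < r < t -> radW 0 r t x = (t ^ 2 - r ^ 2) ^ 2 * P5 0 r t x.
Proof.
  intros H. destruct (zeta_bound r t x H).
  unfold radW, P1, P2, P3, P4. field. split; lra.
Qed.

Lemma sqrt_radW_0 r t x : 0 < r < t ->
  sqrt (radW 0 r t x) = (t ^ 2 - r ^ 2) * sqrt (P5 0 r t x).
Proof. intros H. rewrite radW_0 by exact H. apply sqrt_sqr_mult. nra. Qed.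

Lemma kerB1_0 r t x : 0 < r < t -> kerB1 0 r t x = 2 / sqrt (P5 0 r t x).
Proof.
  intros H. destruct (zeta_bound r t x H).
  unfold kerB1, W, numW. rewrite Ropp_0, sqrt_radW_0 by exact H.
  field. repeat split; try nra. apply sqrt_neq_0, P5_pos.
Qed.

(* The terms coming from [be] and [t] cancel: only the factor [z^2 + 4]
   contributes to the derivative at [c = 0]. *)
Lemma Wquot_0 r t x : 0 < r < t ->
  Wquot 0 r t x = - 2 * cos x ^ 2 / sqrt (P5 0 r t x) ^ 3.
Proof.
  intros H. destruct (zeta_bound r t x H).
  assert (E1 : sin x ^ 2 * P1 0 r t x = zeta r t x - r).
  { rewrite <- zsub_be by exact H. unfold zsub. ring. }
  assert (E2 : cos x ^ 2 * P2 0 r t x = t - zeta r t x).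
  { rewrite <- zsub_tau by exact H. unfold zsub. ring. }
  assert (E3 : P1 0 r t x * P3 0 r t x = t ^ 2 - r ^ 2).
  { unfold P1, P3. field. lra. }
  assert (E4 : P2 0 r t x * P4 0 r t x = t ^ 2 - r ^ 2).
  { unfold P2, P4. field. lra. }
  assert (E5 : P3 0 r t x = zeta r t x + r) by (unfold P3; ring).
  assert (E6 : P4 0 r t x = t + zeta r t x) by (unfold P4; ring).
  assert (Ed : radW_diff 0 r t x = - 8 * (t ^ 2 - r ^ 2) * zeta r t x * P5 0 r t x
                + 4 * zeta r t x * cos x ^ 2 * (t ^ 2 - r ^ 2) ^ 2).
  { unfold radW_diff. rewrite Ropp_0.
    (* Grouped so that only [P1 * P3], [P2 * P4], [sin^2 * P1] and [cos^2 * P2] occur, each of which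
       is simple at [c = 0]. *)
    transitivity (P5 0 r t x * (- 2 * (P2 0 r t x * P4 0 r t x) * P3 0 r t x
      - 2 * (P1 0 r t x * P3 0 r t x) * P4 0 r t x
      - 2 * (P2 0 r t x * P4 0 r t x) * (sin x ^ 2 * P1 0 r t x)
      + 2 * (P1 0 r t x * P3 0 r t x) * (cos x ^ 2 * P2 0 r t x))
      + 4 * zeta r t x * cos x ^ 2
        * ((P1 0 r t x * P3 0 r t x) * (P2 0 r t x * P4 0 r t x))); [ring|].
    rewrite E1, E2, E3, E4, E5, E6. ring. }
  unfold Wquot. rewrite Ed, Ropp_0, sqrt_radW_0 by exact H.
  unfold numW. rewrite <- (pow2_sqrt (P5 0 r t x)) at 2 by (left; apply P5_pos).
  assert (0 < sqrt (P5 0 r t x)) by apply sqrt_lt_R0, P5_pos.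
  assert (0 < t ^ 2 - r ^ 2) by nra.
  assert (0 < (t ^ 2 - r ^ 2) * sqrt (P5 0 r t x)) by now apply Rmult_lt_0_compat.
  field. repeat split; lra.
Qed.

Lemma intB1_0 r t : 0 < r < t ->
  intB1 0 r t = 2 / sqrt (t ^ 2 + 4) * ellKbar (modulus1 r t).
Proof.
  intros H. destruct (modulus1_bounds r t H). unfold ellKbar.
  rewrite ellK_RInt by lra. unfold intB1.
  rewrite <- (RInt_flip (fun x => / sqrt (1 - (1 - modulus1 r t) * sin x ^ 2)))
    by (intros; apply continuous_invDelta; lra).
  apply RInt_const_mult.
  - intros x. apply (continuous_comp (fun x => PI / 2 - x)
      (fun x => / sqrt (1 - (1 - modulus1 r t) * sin x ^ 2))); [cont|].
    apply continuous_invDelta; lra.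
  - intros x. rewrite kerB1_0, sqrt_P5_0, sin_shift by exact H.
    assert (Hs := sqrt_Delta_pos (1 - modulus1 r t) (PI / 2 - x) ltac:(lra)).
    rewrite sin_shift in Hs.
    field. split; [lra|]. apply sqrt_neq_0; nra.
Qed.

Lemma intB0_0 r t : 0 < r < t ->
  intB0 0 r t = - 2 / sqrt (t ^ 2 + 4) / (t ^ 2 - r ^ 2)
    * (ellEbar (modulus1 r t) / modulus1 r t - ellKbar (modulus1 r t)).
Proof.
  intros H. destruct (modulus1_bounds r t H). unfold ellKbar, ellEbar.
  set (m := 1 - modulus1 r t).
  assert (Hm : m < 1) by (unfold m; lra).
  assert (St : 0 < sqrt (t ^ 2 + 4)) by (apply sqrt_lt_R0; nra).
  assert (E : intB0 0 r t = - 2 / sqrt (t ^ 2 + 4) ^ 3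
    * RInt (fun x => sin x ^ 2 / sqrt (1 - m * sin x ^ 2) ^ 3) 0 (PI / 2)).
  { rewrite <- (RInt_flip (fun x => sin x ^ 2 / sqrt (1 - m * sin x ^ 2) ^ 3))
      by (intros; now apply continuous_s_invDelta3).
    apply RInt_const_mult.
    - intros x. apply (continuous_comp (fun x => PI / 2 - x)
        (fun x => sin x ^ 2 / sqrt (1 - m * sin x ^ 2) ^ 3)); [cont|].
      now apply continuous_s_invDelta3.
    - intros x. rewrite Wquot_0, sqrt_P5_0, sin_shift by exact H.
      assert (Hs := sqrt_Delta_pos m (PI / 2 - x) Hm). rewrite sin_shift in Hs.
      fold m. field. split; lra. }
  rewrite E. assert (S := second_kind m Hm).
  set (I3 := RInt _ 0 (PI / 2)) in *.
  assert (Em : m = (t ^ 2 - r ^ 2) / (t ^ 2 + 4)) by (unfold m, modulus1; field; nra).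
  assert (Em' : 1 - m = modulus1 r t) by (unfold m; ring).
  rewrite Em' in S.
  assert (Hm0 : 0 < m) by (unfold m; lra).
  replace I3 with ((ellE m - modulus1 r t * ellK m) / (m * modulus1 r t))
    by (rewrite <- S; field; lra).
  replace (sqrt (t ^ 2 + 4) ^ 3) with ((t ^ 2 + 4) * sqrt (t ^ 2 + 4))
    by (rewrite <- (pow2_sqrt (t ^ 2 + 4)) at 1 by nra; ring).
  generalize (ellE m) (ellK m). intros e k. rewrite Em.
  field. repeat split; nra.
Qed.

(** The relation [m1 m2 = r^2 / t^2] turns the coefficient [r^2 / m1] of [ellEbar * ellK] into
    [t^2 m2], and the terms in [ellKbar * ellK] add up to [- t^2]; the common factor [t^2] is part
    of [k]. *)
Lemma M_0 r t : 0 < r < t ->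
  exists k, 0 < k /\ M 0 r t = - k * Gfun (modulus1 r t) (modulus2 r t).
Proof.
  intros H.
  assert (St : 0 < sqrt (t ^ 2 + 4)) by (apply sqrt_lt_R0; nra).
  assert (Sr : 0 < sqrt (r ^ 2 + 4)) by (apply sqrt_lt_R0; nra).
  assert (Hk : 0 < kappa r t).
  { unfold kappa. apply Rdiv_lt_0_compat; nra. }
  exists (2 * kappa r t * t ^ 2 / ((t ^ 2 - r ^ 2) * sqrt (t ^ 2 + 4))). split.
  - apply Rdiv_lt_0_compat; [|apply Rmult_lt_0_compat; nra].
    apply Rmult_lt_0_compat; nra.
  - unfold M. rewrite intA0_0, intA1_0, intB0_0, intB1_0 by exact H. unfold Gfun.
    generalize (ellK (modulus2 r t)) (ellE (modulus2 r t))
      (ellKbar (modulus1 r t)) (ellEbar (modulus1 r t)).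
    intros K E Kb Eb. unfold modulus1, modulus2. field. repeat split; nra.
Qed.

(** * The closure *)

(** If [M] were nonzero at the diagonal point, it would stay nonzero nearby. But a point of [X]
    nearby has [c > 0] and [Qfun = 0], which forces [M = 0] there. *)
Lemma closure_imp_M_0 al tau : 0 < al < tau ->
  in_closure_X al al tau -> M 0 al tau = 0.
Proof.
  intros H Hcl. apply NNPP. intros HM.
  set (p0 := ((0, al), tau) : R * R * R).
  assert (C1 : continuous (fun p : R * R * R => fst (fst p)) p0) by cont.
  assert (C2 : continuous (fun p : R * R * R => snd (fst p)) p0) by cont.
  assert (C3 : continuous (fun p : R * R * R => snd p) p0) by cont.
  assert (Hd : dom 0 al tau) by (apply dom_0; lra).
  assert (CM := continuous_M _ _ _ p0 C1 C2 C3 Hd).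
  assert (L1 := locally_dom _ _ _ p0 C1 C2 C3 Hd).
  assert (L2 : locally p0 (fun p : R * R * R =>
            0 < Rabs (M (fst (fst p)) (snd (fst p)) (snd p)))).
  { apply (locally_pos (fun p : R * R * R =>
            Rabs (M (fst (fst p)) (snd (fst p)) (snd p)))).
    - apply (continuous_comp _ Rabs); [exact CM|apply continuous_Rabs].
    - now apply Rabs_pos_lt. }
  destruct (filter_and _ _ L1 L2) as [d Hd'].
  destruct (Hcl d (cond_pos d)) as [a [b [t [HX [Ha [Hb Ht]]]]]].
  destruct HX as [X1 [X2 [X3 [X4 X5]]]].
  apply Rabs_def2 in Ha, Hb.
  (* The coordinates [(c, r, t)] of the point [(a, b, t)] of [X]. *)
  destruct (Hd' (((b - a) / 2, (a + b) / 2), t)) as [D1 D2].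
  { repeat split; [| |exact Ht].
    - change (Rabs ((b - a) / 2 - 0) < d). apply Rabs_def1; lra.
    - change (Rabs ((a + b) / 2 - al) < d). apply Rabs_def1; lra. }
  simpl in D1, D2.
  assert (HQ := proj1 (Qfun_zero_iff ((b - a) / 2) ((a + b) / 2) t D1 ltac:(lra))).
  replace ((a + b) / 2 - (b - a) / 2) with a in HQ by field.
  replace ((a + b) / 2 + (b - a) / 2) with b in HQ by field.
  rewrite HQ, Rabs_R0 in D2 by exact X5. lra.
Qed.

(** The equation [modulus1 r t = m1] solved for [r]. Where the radicand is negative the value is 0,
    so positivity of [rcurve] certifies that the equation holds. *)
Definition rcurve (m1 t : R) : R := sqrt (m1 * (t ^ 2 + 4) - 4).

Lemma continuous_rcurve m1 t : continuous (rcurve m1) t.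
Proof. unfold rcurve. cont. Qed.

Lemma rcurve_modulus1 m1 t : 0 < rcurve m1 t -> modulus1 (rcurve m1 t) t = m1.
Proof.
  intros H. unfold modulus1.
  assert (E : rcurve m1 t ^ 2 = m1 * (t ^ 2 + 4) - 4).
  { unfold rcurve in *. apply pow2_sqrt. apply Rnot_lt_le. intros Hn.
    rewrite sqrt_neg_0 in H; lra. }
  rewrite E. field. nra.
Qed.

(** Along the curve [m2 = 1 - 4 (1 - m1) / (m1 t^2)], which increases with [t]. *)
Lemma rcurve_modulus2 m1 t t' : 0 < m1 < 1 ->
  0 < rcurve m1 t -> 0 < rcurve m1 t' -> 0 < t < t' ->
  modulus2 (rcurve m1 t) t < modulus2 (rcurve m1 t') t'.
Proof.
  intros Hm H H' Ht.
  assert (E : forall t, 0 < t -> 0 < rcurve m1 t ->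
    modulus2 (rcurve m1 t) t = 1 - 4 * (1 - m1) / m1 * / t ^ 2).
  { intros s Hs Hr. unfold modulus2.
    assert (E1 := rcurve_modulus1 m1 s Hr). unfold modulus1 in E1.
    assert (E2 : rcurve m1 s ^ 2 = m1 * (s ^ 2 + 4) - 4).
    { rewrite <- E1 at 2. field. nra. }
    rewrite E2. field. repeat split; nra. }
  rewrite !E by lra.
  assert (/ t' ^ 2 < / t ^ 2) by (apply Rinv_lt_contravar; [apply Rmult_lt_0_compat|]; nra).
  assert (0 < 4 * (1 - m1) / m1) by (apply Rdiv_lt_0_compat; lra).
  nra.
Qed.

Lemma zero_imp_closure al tau : 0 < al < tau ->
  Gfun (modulus1 al tau) (modulus2 al tau) = 0 -> in_closure_X al al tau.
Proof.
  intros H HG eps Heps.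
  set (m1 := modulus1 al tau) in *.
  assert (Hm1 : 0 < m1 < 1) by now apply modulus1_bounds.
  assert (Er : rcurve m1 tau = al).
  { unfold rcurve, m1, modulus1.
    replace ((al ^ 2 + 4) / (tau ^ 2 + 4) * (tau ^ 2 + 4) - 4) with (al ^ 2)
      by (field; nra).
    apply sqrt_pow2. lra. }
  (* With [r] and [t] within [e] of [al] and [tau] and [c] below [e / 2], the first bound places
     [r - c], [r + c] and [t] within [eps]; the second gives [c < r], the third [2 c < t - r]. *)
  assert (He : 0 < Rmin (eps / 2) (Rmin (al / 2) ((tau - al) / 4))).
  { repeat apply Rmin_glb_lt; lra. }
  set (e := Rmin (eps / 2) (Rmin (al / 2) ((tau - al) / 4))) in *.
  assert (He1 : e <= eps / 2) by apply Rmin_l.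
  assert (He2 : e <= al / 2) by (eapply Rle_trans; [apply Rmin_r|apply Rmin_l]).
  assert (He3 : e <= (tau - al) / 4)
    by (eapply Rle_trans; [apply Rmin_r|apply Rmin_r]).
  destruct (proj1 (filterlim_locally _ _) (continuous_rcurve m1 tau)
    (mkposreal e He)) as [d0 Hd0].
  set (d := Rmin d0 e).
  assert (Hd : 0 < d) by (apply Rmin_glb_lt; [apply cond_pos|exact He]).
  assert (Hde : d <= e) by apply Rmin_r.
  assert (Hdd : d <= d0) by apply Rmin_l.
  assert (Hr : forall t, tau - d < t < tau + d -> al - e < rcurve m1 t < al + e).
  { intros t Ht. assert (Hb : ball tau d0 t).
    { change (Rabs (t - tau) < d0). apply Rabs_def1; lra. }
    specialize (Hd0 t Hb). rewrite Er in Hd0.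
    change (Rabs (rcurve m1 t - al) < e) in Hd0. apply Rabs_def2 in Hd0. lra. }
  assert (Hdom : forall c t, tau - d < t < tau + d -> - (e / 2) < c < e / 2 ->
            dom c (rcurve m1 t) t).
  { intros c t Ht Hc. specialize (Hr t Ht). unfold dom. lra. }
  (* Two points of the curve on either side of [tau]: [modulus2] lies below its critical value at
     [t1] and above it at [t2], so [M 0] is negative at [t1] and positive at [t2]. *)
  set (t1 := tau - d / 2). set (t2 := tau + d / 2).
  assert (Ht1 : tau - d < t1 < tau + d) by (unfold t1; lra).
  assert (Ht2 : tau - d < t2 < tau + d) by (unfold t2; lra).
  assert (Hr1 := Hr t1 Ht1). assert (Hr2 := Hr t2 Ht2).
  assert (Hm : modulus2 al tau < 1) by (now apply modulus2_bounds).
  assert (M1 : 0 < - M 0 (rcurve m1 t1) t1).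
  { destruct (M_0 (rcurve m1 t1) t1) as [k [Hk ->]]; [lra|].
    rewrite rcurve_modulus1 by lra.
    assert (HG1 : 0 < Gfun m1 (modulus2 (rcurve m1 t1) t1)); [|nra].
    apply Gfun_sign_left with (modulus2 al tau); [lra| |exact Hm|exact HG].
    split; [apply modulus2_bounds; lra|].
    rewrite <- Er at 1. apply rcurve_modulus2; unfold t1 in *; lra. }
  assert (M2 : 0 < M 0 (rcurve m1 t2) t2).
  { destruct (M_0 (rcurve m1 t2) t2) as [k [Hk ->]]; [lra|].
    rewrite rcurve_modulus1 by lra.
    assert (HG1 : Gfun m1 (modulus2 (rcurve m1 t2) t2) < 0); [|nra].
    apply Gfun_sign_right with (modulus2 al tau); [lra| | |exact HG].
    - split; [now apply modulus2_bounds|].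
      rewrite <- Er at 1. apply rcurve_modulus2; unfold t2 in *; lra.
    - apply modulus2_bounds; lra. }
  assert (HcM : forall t, tau - d < t < tau + d ->
    continuous (fun c => M c (rcurve m1 t) t) 0).
  { intros t Ht. apply (continuous_M (fun c => c) (fun _ => rcurve m1 t) (fun _ => t));
      [apply continuous_id|apply continuous_const|apply continuous_const|].
    apply Hdom; lra. }
  destruct (locally_pos (fun c => - M c (rcurve m1 t1) t1) 0
    (continuous_Ropp _ _ (HcM t1 Ht1)) M1) as [e1 L1].
  destruct (locally_pos (fun c => M c (rcurve m1 t2) t2) 0
    (HcM t2 Ht2) M2) as [e2 L2].
  (* Small enough to preserve both strict signs found at [c = 0]; the division by 3 also ensures
     [c < e / 2]. *)
  set (c := Rmin e (Rmin e1 e2) / 3).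
  assert (H0 : 0 < Rmin e (Rmin e1 e2)).
  { apply Rmin_glb_lt; [exact He|apply Rmin_glb_lt; apply cond_pos]. }
  assert (H1 : Rmin e (Rmin e1 e2) <= e) by apply Rmin_l.
  assert (H2 : Rmin e (Rmin e1 e2) <= e1)
    by (eapply Rle_trans; [apply Rmin_r|apply Rmin_l]).
  assert (H3 : Rmin e (Rmin e1 e2) <= e2)
    by (eapply Rle_trans; [apply Rmin_r|apply Rmin_r]).
  assert (N1 : 0 < - M c (rcurve m1 t1) t1).
  { apply L1. change (Rabs (c - 0) < e1). unfold c. apply Rabs_def1; lra. }
  assert (N2 : 0 < M c (rcurve m1 t2) t2).
  { apply L2. change (Rabs (c - 0) < e2). unfold c. apply Rabs_def1; lra. }
  assert (Hc : 0 < c < e / 2) by (unfold c; lra).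
  destruct (Ranalysis5.IVT_interv (fun t => M c (rcurve m1 t) t) t1 t2)
    as [t [Ht HMt]].
  - intros t Ht. apply continuity_pt_filterlim.
    apply (continuous_M (fun _ => c) (rcurve m1) (fun t => t));
      [apply continuous_const|apply continuous_rcurve|apply continuous_id|].
    apply Hdom; unfold t1, t2 in *; lra.
  - unfold t1, t2; lra.
  - lra.
  - exact N2.
  - assert (Htd : tau - d < t < tau + d) by (unfold t1, t2 in *; lra).
    assert (Hrt := Hr t Htd).
    exists (rcurve m1 t - c), (rcurve m1 t + c), t.
    repeat split; try lra.
    + apply Qfun_zero_iff; [apply Hdom; lra|lra|exact HMt].
    + apply Rabs_def1; lra.
    + apply Rabs_def1; lra.
    + apply Rabs_def1; lra.
Qed.

Theorem mainTheorem9 (al tau : R) (Hal : 0 < al) (Hat : al < tau) :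
  let m1 := (al ^ 2 + 4) / (tau ^ 2 + 4) in
  let m2 := (al ^ 2 / tau ^ 2) * ((tau ^ 2 + 4) / (al ^ 2 + 4)) in
  (0 < m1 < 1 /\ 0 < m2 < 1) /\
  (in_closure_X al al tau <->
   ellKbar m1 * ellE m2 + m2 * ellEbar m1 * ellK m2 = ellKbar m1 * ellK m2).
Proof.
  intros m1 m2. assert (H : 0 < al < tau) by lra.
  split; [split; [now apply modulus1_bounds|now apply modulus2_bounds]|].
  split; intros HC.
  - apply closure_imp_M_0 in HC; [|exact H].
    destruct (M_0 al tau H) as [k [Hk E]]. rewrite HC in E.
    assert (HG : Gfun (modulus1 al tau) (modulus2 al tau) = 0) by nra.
    apply Rminus_diag_uniq. exact HG.
  - apply zero_imp_closure; [exact H|]. apply Rminus_diag_eq. exact HC.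
Qed.
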